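(* Let $(E,Q_E)$ and $(F,Q_F)$ be Lie $\infty$-algebras of finite dimension, with functions $\mathcal E$, $\mathcal F$, and let $\Phi^*:(\mathcal E,Q_E)\to(\mathcal F,Q_F)$ and $\Psi^*:(\mathcal F,Q_F)\to(\mathcal E,Q_E)$ form a homotopy equivalence. Then the modular classes are intertwined: $$\Phi^*[\omega_E]=[\omega_F]\quad\text{and}\quad\Psi^*[\omega_F]=[\omega_E].$$
   Context: Graded vector spaces are $\mathbb Z$-graded over $\mathbb K=\mathbb R$ or $\mathbb C$, of finite total dimension; $|x|$ is the degree of $x$, and $(E^* )_i=(E_{-i})^*$. $S(E)$ is the graded symmetric algebra with product $\odot$ ($x\odot y=(-1)^{|x||y|}y\odot x$). The Koszul sign $\epsilon(\sigma)$ is defined by $x_{\sigma(1)}\odot\cdots\odot x_{\sigma(n)}=\epsilon(\sigma)\,x_1\odot\cdots\odot x_n$, and $Sh(i,n-i)$ is the set of $\sigma\in S_n$ with $\sigma(1)<\dots<\sigma(i)$ and $\sigma(i+1)<\dots<\sigma(n)$. A (symmetric) Lie $\infty$-algebra structure on $E$ is a family of degree $+1$ linear maps $l_k:S^k(E)\to E$, $k\ge1$, with $$\sum_{i+j=n+1}\sum_{\sigma\in Sh(i,j-1)}\epsilon(\sigma)\,l_j(l_i(x_{\sigma(1)},\dots,x_{\sigma(i)}),x_{\sigma(i+1)},\dots,x_{\sigma(n)})=0$$ for all $n\ge 1$ and homogeneous $x_1,\dots,x_n\in E$. Identify $S^k(E^* )$ with $(S^kE)^*$ via $(f_1\odot\cdots\odot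 f_k)(x_1\odot\cdots\odot x_k)=\sum_{\sigma\in S_k}\epsilon(\sigma)(f_1\otimes\cdots\otimes f_k)(x_{\sigma(1)}\otimes\cdots\otimes x_{\sigma(k)})$, with the Koszul rule $(f\otimes g)(x\otimes y)=(-1)^{|x||g|}f(x)g(y)$ (iterated). The algebra of functions $\mathcal E$ consists of formal sums $\sum_{k\ge1}F^{(k)}$ with $F^{(k)}\in S^k(E^* )$ (arity $k$); $\mathcal E_n$ denotes functions of degree $n$. The derivation $Q_E:\mathcal E\to\mathcal E$ of degree $+1$, squaring to zero, is $Q_E=\sum_{k\ge0}Q_E^{(k)}$ with $Q_E^{(k)}(\xi)(x_1\odot\cdots\odot x_{k+1})=(-1)^{|\xi|}\langle\xi,l_{k+1}(x_1,\dots,x_{k+1})\rangle$ for $\xi\in E^*$. $H^\bullet(E,Q_E)$ is the cohomology of $(\mathcal E,Q_E)$. A Lie $\infty$-algebra morphism from $E$ to $F$ is given by a family of degree $0$ linear maps $\Phi_k:S^k(E)\to F$, $k\ge 1$, such that the graded algebra morphism $\mathcal F\to\mathcal E$ extending their duals $F^*\to S^k(E^* )$ commutes with $Q_F,Q_E$; it is identified with this algebra morphism. Homotopy: a homotopy between two morphisms $\Phi^*,\Psi^*:(\mathcal F,Q_F)\to(\mathcal E,Q_E)$ is a morphism of differential graded commutative algebras $\Xi^*:(\mathcal F,Q_F)\to(\mathcal E\otimes\Omega^\bullet([0,1]),\,Q_E\otimes\mathrm{id}+\mathrm{id}\otimes d_{dR})$ which coincides with $\Phi^*$ and $\Psi^*$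 at $t=0$ and $t=1$ respectively. Here elements of $\mathcal E\otimes\Omega^\bullet([0,1])$ are of the form $G_t\otimes1+H_t\otimes dt$ with $G_t,H_t\in\mathcal E$ depending smoothly on $t\in[0,1]$ (arity by arity). A homotopy equivalence is a pair of morphisms $\Phi^*:(\mathcal E,Q_E)\to(\mathcal F,Q_F)$, $\Psi^*:(\mathcal F,Q_F)\to(\mathcal E,Q_E)$ such that $\Phi^*\circ\Psi^*$ and $\Psi^*\circ\Phi^*$ are homotopic to the identity. Modular function: $\omega_E=\sum_{k\ge1}\omega^{(k)}\in\mathcal E_{+1}$, where for homogeneous $x_1,\dots,x_k\in E$ whose degrees add up to $-1$, $\omega^{(k)}(x_1,\dots,x_k)=\mathrm{Str}\big(l_{k+1}(x_1,\dots,x_k,-)\big)$, with $\mathrm{Str}(\phi)=\sum_i(-1)^i\mathrm{tr}(\phi|_{E_i})$. It is $Q_E$-closed and its class $[\omega_E]\in H^1(E,Q_E)$ is the modular class of $E$. *)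

(* Defs.v *)
From HB Require Import structures.
From mathcomp Require Import all_boot all_order all_algebra all_fingroup.
From mathcomp Require Import complex.
From mathcomp Require Import all_classical all_reals all_analysis.

Set Implicit Arguments.
Unset Strict Implicit.
Unset Printing Implicit Defensive.

Import Order.TTheory GRing.Theory Num.Theory.
Import numFieldNormedType.Exports.
Local Open Scope classical_set_scope.
Local Open Scope ring_scope.

Variant ground := RealGround | ComplexGround.

Section Scalars.
Variable R : realType.

Definition scalars (c : ground) : numFieldType :=
  match c with RealGround => R : numFieldType | ComplexGround => R[i] : numFieldType end.

Definition sc_re (c : ground) : scalars c -> R :=
  match c return scalars c -> R with
  | RealGround => fun z => z
  | ComplexGround => fun z => complex.Re z
  end.

Definition sc_im (c : ground) : scalars c -> R :=
  match c return scalars c -> R with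
  | RealGround => fun=> 0
  | ComplexGround => fun z => complex.Im z
  end.

(* The imaginary part [b] is ignored over the reals. *)
Definition sc_mk (c : ground) (a b : R) : scalars c :=
  match c return scalars c with
  | RealGround => a
  | ComplexGround => Complex a b
  end.

Definition smooth_real (g : R -> R) : Prop :=
  forall (n : nat) (t : R), derivable (derive1n n g) t 1.

(* A smooth function on the compact interval [0,1] is represented by a smooth
   function on the line; below, only its values on [0,1] are ever compared. *)
Definition smooth (c : ground) (g : R -> scalars c) : Prop :=
  smooth_real (@sc_re c \o g) /\ smooth_real (@sc_im c \o g).

Definition ddt (c : ground) (g : R -> scalars c) (t : R) : scalars c :=
  sc_mk c (derive1 (@sc_re c \o g) t) (derive1 (@sc_im c \o g) t).

End Scalars.

Record gradedVect (K : fieldType) := GradedVect {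
  gpiece :> int -> vectType K;
  gpiece_fin : finite_set [set i : int | \dim {:gpiece i} != 0%N]
}.

Section Graded.
Variable K : fieldType.
Implicit Types E F : gradedVect K.

(* Homogeneous elements together with their degree [tag x]. All multilinear
   maps below are given by their values on homogeneous arguments. *)
Definition homog E := {i : int & E i}.

Definition hom_of E (i : int) (v : E i) : homog E :=
  existT (fun j : int => (E j : Type)) i v.

Definition deg E (s : seq (homog E)) : int := \sum_(x <- s) tag x.

(* (x_sigma(1), ..., x_sigma(n)) for s = (x_1, ..., x_n) *)
Definition permute E (s : seq (homog E)) (sigma : 'S_(size s)) : seq (homog E) :=
  [seq tnth (in_tuple s) (sigma a) | a <- enum 'I_(size s)].

(* Explicit form of the sign relating x_sigma(1) ... x_sigma(n) to x_1 ... x_n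
   in the graded symmetric algebra: one factor for each inversion. *)
Definition koszul E (s : seq (homog E)) (sigma : 'S_(size s)) : K :=
  let d a := tag (tnth (in_tuple s) (sigma a)) in
  \prod_(a < size s) \prod_(b < size s | ((a < b) && (sigma b < sigma a))%N)
    (-1) ^ (d a * d b).

Definition shuffle (p n : nat) (sigma : 'S_n) : bool :=
  [forall a : 'I_n, forall b : 'I_n,
     ((a < b) && ((b < p) || (p <= a)) ==> (sigma a < sigma b))%N].

(* A family of maps on k-tuples of homogeneous elements, for all k at once:
   the restriction to sequences of length k is the component of arity k. *)
Definition cochain E := seq (homog E) -> K.

(* Elements of the algebra of functions: S^k(E^* ) is identified with the dual
   of S^k(E), i.e. with graded symmetric k-linear forms; arities are >= 1. *)
Record is_function E (f : cochain E) : Prop := IsFunction {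
  function_nil : f [::] = 0;
  function_multilinear : forall (s1 s2 : seq (homog E)) (i : int) (a : K) (u v : E i),
    f (s1 ++ hom_of (a *: u + v) :: s2) =
      a * f (s1 ++ hom_of u :: s2) + f (s1 ++ hom_of v :: s2);
  function_symmetric : forall (s : seq (homog E)) (sigma : 'S_(size s)),
    f (permute sigma) = koszul sigma * f s
}.

(* Since (E^* )_i = (E_{-i})^*, a function of degree n only sees arguments of
   total degree - n. *)
Definition fun_of_degree E (n : int) (f : cochain E) : Prop :=
  is_function f /\ forall s, deg s != - n -> f s = 0.

Definition linear_form E (xi : cochain E) : Prop :=
  is_function xi /\ forall s, size s != 1%N -> xi s = 0.

(* The product of S(E^* ) through the identification of S^k(E^* ) with the dual of
   S^k(E). The last sign is the Koszul sign (-1)^(|x||g|) of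
   (f (x) g)(x (x) y), as g(y) vanishes unless |g| = - |y|. *)
Definition fun_mul E (f g : cochain E) : cochain E := fun s =>
  \sum_(1 <= p < size s) \sum_(sigma : 'S_(size s) | shuffle p sigma)
    koszul sigma *
    (-1) ^ (deg (take p (permute sigma)) * deg (drop p (permute sigma))) *
    (f (take p (permute sigma)) * g (drop p (permute sigma))).

(* f |-> (-1)^|f| f, extended to inhomogeneous functions *)
Definition fun_sign E (f : cochain E) : cochain E := fun s => (-1) ^ deg s * f s.

(* [phi s e] is the component in F_e of the value phi_k(x_1, ..., x_k),
   where s = (x_1, ..., x_k). *)
Definition multimap E F := seq (homog E) -> forall e : int, F e.

Record is_multimap E F (d : int) (phi : multimap E F) : Prop := IsMultimap {
  multimap_nil : forall e, phi [::] e = 0;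
  multimap_multilinear :
    forall (s1 s2 : seq (homog E)) (i : int) (a : K) (u v : E i) (e : int),
    phi (s1 ++ hom_of (a *: u + v) :: s2) e =
      a *: phi (s1 ++ hom_of u :: s2) e + phi (s1 ++ hom_of v :: s2) e;
  multimap_symmetric : forall (s : seq (homog E)) (sigma : 'S_(size s)) (e : int),
    phi (permute sigma) e = koszul sigma *: phi s e;
  multimap_degree : forall s e, e != deg s + d -> phi s e = 0
}.

(* The value of a family of maps of degree d, as a homogeneous element. *)
Definition hval E F (d : int) (phi : multimap E F) (s : seq (homog E)) : homog F :=
  hom_of (phi s (deg s + d)).

End Graded.

Record lieInfty (K : fieldType) := LieInfty {
  space :> gradedVect K;
  bracket : multimap space space;
  bracket_multimap : is_multimap 1 bracket;
  (* l_j(l_i(x_sigma(1), ..., x_sigma(i)), x_sigma(i+1), ..., x_sigma(n));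
     i + j = n + 1 with j >= 1 amounts to i <= n *)
  bracket_jacobi : forall (s : seq (homog space)) (e : int),
    \sum_(1 <= i < (size s).+1) \sum_(sigma : 'S_(size s) | shuffle i sigma)
      koszul sigma *:
        bracket (hval 1 bracket (take i (permute sigma)) :: drop i (permute sigma)) e
    = 0
}.

Section LieInfinity.
Variable K : fieldType.
Implicit Types E F : lieInfty K.

(* The last field is the definition of Q_E on the dual of E, the degree 1 derivation being
   determined by these values. *)
Record is_differential E (Q : cochain E -> cochain E) : Prop := IsDifferential {
  differential_fun : forall f, is_function f -> is_function (Q f);
  differential_degree : forall (n : int) f, fun_of_degree n f -> fun_of_degree (n + 1) (Q f);
  differential_linear : forall (a : K) f g, is_function f -> is_function g ->
    Q ((a \*o f) \+ g) = (a \*o Q f) \+ Q g;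
  differential_leibniz : forall (n : int) f g, fun_of_degree n f -> is_function g ->
    Q (fun_mul f g) = fun_mul (Q f) g \+ ((-1) ^ n \*o fun_mul f (Q g));
  differential_square : forall f, is_function f -> forall s, Q (Q f) s = 0;
  differential_dual : forall (n : int) xi, linear_form xi -> fun_of_degree n xi ->
    forall s, Q xi s = (-1) ^ n * xi [:: hval 1 (@bracket K E) s]
}.

(* [P], from functions on F to functions on E, is the algebra morphism dual to a
   Lie infinity-algebra morphism from E to F. *)
Record is_morphism E F (QE : cochain E -> cochain E) (QF : cochain F -> cochain F)
    (P : cochain F -> cochain E) : Prop := IsMorphism {
  morphism_fun : forall f, is_function f -> is_function (P f);
  morphism_degree : forall (n : int) f, fun_of_degree n f -> fun_of_degree n (P f);
  morphism_linear : forall (a : K) f g, is_function f -> is_function g ->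
    P ((a \*o f) \+ g) = (a \*o P f) \+ P g;
  morphism_mul : forall f g, is_function f -> is_function g ->
    P (fun_mul f g) = fun_mul (P f) (P g);
  morphism_dual : exists2 phi : multimap E F, is_multimap 0 phi &
    forall xi, linear_form xi -> forall s, P xi s = xi [:: hval 0 phi s];
  morphism_differential : forall f, is_function f -> P (QF f) = QE (P f)
}.

Definition trace (V : vectType K) (h : V -> V) : K :=
  \sum_(a < \dim {:V}) coord (vbasis {:V}) a (h (vbasis {:V})`_a).

Definition supertrace E (h : forall i : int, E i -> E i) : K :=
  \sum_(i \in [set: int]) (-1) ^ i * trace (h i).

(* Only the component in E_i of l(x_1, ..., x_k, v) enters, for v in E_i: the
   result vanishes unless the degrees of the x_j add up to -1, in particular on
   the empty sequence. *)
Definition modular_function E : cochain E := fun s =>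
  supertrace (fun (i : int) (v : E i) => @bracket K E (rcons s (hom_of v)) i).

(* For a cocycle w, the element [w] of H^n as the coset of w modulo Q-exact
   functions. *)
Definition coh_class E (Q : cochain E -> cochain E) (n : int) (w : cochain E) :
    set (cochain E) :=
  [set h | exists2 g, fun_of_degree (n - 1) g & h = w \+ Q g].

(* The union over all representatives: the class of P w, for any w in C, when P
   is a chain map. *)
Definition coh_map E F (QE : cochain E -> cochain E) (n : int)
    (P : cochain F -> cochain E) (C : set (cochain F)) : set (cochain E) :=
  \bigcup_(w in C) coh_class QE n (P w).

Definition modular_class E (Q : cochain E -> cochain E) : set (cochain E) :=
  coh_class Q 1 (@modular_function E).

End LieInfinity.

Section Homotopy.
Variables (R : realType) (c : ground).
Implicit Types E F : lieInfty (scalars R c).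

(* (G, H) stands for G_t (x) 1 + H_t (x) dt. *)
Definition dRform E : Type := ((R -> cochain E) * (R -> cochain E))%type.

Definition dR_eq E (A B : dRform E) : Prop :=
  forall t, 0 <= t <= 1 -> A.1 t = B.1 t /\ A.2 t = B.2 t.

Definition smooth_family E (G : R -> cochain E) : Prop :=
  (forall t, 0 <= t <= 1 -> is_function (G t)) /\
  (forall s, smooth (fun t => G t s)).

Definition is_dRform E (A : dRform E) : Prop :=
  smooth_family A.1 /\ smooth_family A.2.

Definition dRform_of_degree E (n : int) (A : dRform E) : Prop :=
  is_dRform A /\ forall t, 0 <= t <= 1 ->
    fun_of_degree n (A.1 t) /\ fun_of_degree (n - 1) (A.2 t).

Definition dR_lin E (a : scalars R c) (A B : dRform E) : dRform E :=
  (fun t => (a \*o A.1 t) \+ B.1 t, fun t => (a \*o A.2 t) \+ B.2 t).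

(* (H (x) dt)(G' (x) 1) = (-1)^|G'| HG' (x) dt *)
Definition dR_mul E (A B : dRform E) : dRform E :=
  (fun t => fun_mul (A.1 t) (B.1 t),
   fun t => fun_mul (A.1 t) (B.2 t) \+ fun_mul (A.2 t) (fun_sign (B.1 t))).

(* Q (x) id + id (x) d, where (id (x) d)(G (x) 1) = (-1)^|G| (dG/dt) (x) dt *)
Definition dR_diff E (Q : cochain E -> cochain E) (A : dRform E) : dRform E :=
  (fun t => Q (A.1 t),
   fun t => Q (A.2 t) \+ fun_sign (fun s => ddt (fun u => A.1 u s) t)).

Record is_homotopy E F (QE : cochain E -> cochain E) (QF : cochain F -> cochain F)
    (P P' : cochain F -> cochain E) (Xi : cochain F -> dRform E) : Prop := IsHomotopy {
  homotopy_form : forall f, is_function f -> is_dRform (Xi f);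
  homotopy_degree : forall (n : int) f, fun_of_degree n f -> dRform_of_degree n (Xi f);
  homotopy_linear : forall (a : scalars R c) f g, is_function f -> is_function g ->
    dR_eq (Xi ((a \*o f) \+ g)) (dR_lin a (Xi f) (Xi g));
  homotopy_mul : forall f g, is_function f -> is_function g ->
    dR_eq (Xi (fun_mul f g)) (dR_mul (Xi f) (Xi g));
  homotopy_differential : forall f, is_function f ->
    dR_eq (Xi (QF f)) (dR_diff QE (Xi f));
  homotopy_at0 : forall f, is_function f -> (Xi f).1 0 = P f;
  homotopy_at1 : forall f, is_function f -> (Xi f).1 1 = P' f
}.

Definition homotopic E F (QE : cochain E -> cochain E) (QF : cochain F -> cochain F)
    (P P' : cochain F -> cochain E) : Prop :=
  exists Xi : cochain F -> dRform E, is_homotopy QE QF P P' Xi.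

Record homotopy_equivalence E F (QE : cochain E -> cochain E)
    (QF : cochain F -> cochain F) (Phi : cochain E -> cochain F)
    (Psi : cochain F -> cochain E) : Prop := HomotopyEquivalence {
  hequiv_Phi : is_morphism QF QE Phi;
  hequiv_Psi : is_morphism QE QF Psi;
  hequiv_F : homotopic QF QF (Phi \o Psi) id;
  hequiv_E : homotopic QE QE (Psi \o Phi) id
}.

End Homotopy.

(* Main.v *)
(* In homogeneous coordinates [xi_j] the matrix [A] of the derivatives [d_i (Q xi_j)]
   satisfies the flatness equation [Q A + A A = 0] (up to signs), because [Q Q = 0], and
   its trace is the modular function. The Jacobian [J] of a morphism [P] intertwines the
   matrices of source and target, so that [[A_E, J], [0, - P A_F]] is again flat, with
   trace [omega_E - P omega_F].
   Its part of arity 0 is the mapping cone of the linear part of the morphism; a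
   homotopy equivalence makes this cone acyclic, as the pairing of a cocycle with a cycle
   has zero derivative along a homotopy. Given a constant contraction [h] of
   the cone, [g = 1 + h (A - A_0)] is a gauge transformation to the constant part
   [A_0], which has trace 0; hence the trace of [A] is the differential of the
   supertrace of [log g], a function of degree 0. *)
From HB Require Import structures.
Require Import Defs.
From mathcomp Require Import all_boot all_order all_algebra all_fingroup.
From mathcomp Require Import complex finmap.
From mathcomp Require Import all_classical all_reals all_analysis.
From mathcomp Require Import ring zify.

Set Implicit Arguments.
Unset Strict Implicit.
Unset Printing Implicit Defensive.

Import Order.TTheory GRing.Theory Num.Theory.
Local Open Scope ring_scope.

(** * The signed shuffle algebra *)

(** The gauge argument computes with matrices of functions, so functions have to lie in a ring. The
    signed shuffle product is associative, unital and graded commutative on all cochains, symmetric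
    or not; the ring is therefore taken there, and symmetry becomes a predicate [symf] carried
    along. This ring has constants, which Jacobians and gauge transformations require, whereas
    functions have no constant term: [aug] and [unital_ext] pass between the two settings. Functions
    are formal series, so a derivation or a morphism is not reached from generators by finite
    expansions. Instead, Euler's formula divided by the arity writes a function as its constant term
    plus a sum of products xi_i g_i, and identities follow by induction on the arity. The same
    filtration makes the logarithm of g a finite sum on each word, as g has constant part 1. The
    acyclicity of the cone only involves linear parts, where a homotopy yields a derivative that is
    a coboundary; the mean value theorem is then all the analysis that enters. *)

Section Signs.
Variable K : fieldType.

Definition sg (i : int) : K := (-1) ^ i.

(** In this form identities between signs become identities between parities, left to [lia] or to a
    case analysis. *)
Lemma sgE i : sg i = (-1) ^+ odd `|i|%N.
Proof.
rewrite /sg; case: i => n; first by rewrite signr_odd.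
by rewrite NegzE -exprz_inv invrN1 abszN -exprnP signr_odd.
Qed.

Lemma oddzD (i j : int) : odd `|(i + j)%R|%N = odd `|i|%N (+) odd `|j|%N.
Proof. lia. Qed.

Lemma sgD i j : sg (i + j) = sg i * sg j.
Proof. by rewrite !sgE oddzD signr_addb. Qed.

Lemma sgN i : sg (- i) = sg i.
Proof. by rewrite !sgE abszN. Qed.

Lemma sg0 : sg 0 = 1. Proof. by []. Qed.

Lemma sg1 : sg 1 = -1. Proof. by []. Qed.

Lemma sgsq i : sg i * sg i = 1.
Proof. by rewrite sgE -expr2 sqrr_sign. Qed.

Lemma sgsqK i (x : K) : sg i * (sg i * x) = x.
Proof. by rewrite mulrA sgsq mul1r. Qed.

End Signs.

Section ShuffleAlgebra.
Variables (K : numFieldType) (E : gradedVect K).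

(** An alias convertible to [cochain E], so that the product found on it is the shuffle product and
    results pass to cochains as they are. *)
Definition shuf : Type := cochain E.

Implicit Types (f g h : shuf) (s : seq (homog E)) (x y : homog E).

HB.instance Definition _ := Choice.copy shuf (seq (homog E) -> K).

Definition shuf_add f g : shuf := fun s => f s + g s.
Definition shuf_opp f : shuf := fun s => - f s.
Definition shuf_zero : shuf := fun=> 0.

Let addA : associative shuf_add.
Proof. by move=> f g h; apply/funext=> s; apply: addrA. Qed.
Let addC : commutative shuf_add.
Proof. by move=> f g; apply/funext=> s; apply: addrC. Qed.
Let add0 : left_id shuf_zero shuf_add.
Proof. by move=> f; apply/funext=> s; apply: add0r. Qed.
Let addN : left_inverse shuf_zero shuf_opp shuf_add.
Proof. by move=> f; apply/funext=> s; apply: addNr. Qed.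

HB.instance Definition _ := GRing.isZmodule.Build shuf addA addC add0 addN.

(** [dl] serves inductions on words. [dr x] is contraction with x, a signed derivation by [dr_mul];
    at a basis vector it is a partial derivative. On homogeneous functions [tw k] is a mere sign, by
    [tw_hdeg]. *)
Definition dl x f : shuf := fun s => f (x :: s).
Definition dr x f : shuf := fun s => f (rcons s x).
Definition tw (k : int) f : shuf := fun s => sg K (k * deg s) * f s.

Definition shuf_scale (a : K) f : shuf := fun s => a * f s.

(* A letter put in the first factor is signed against the letters after it that go to
   the second: in [fun_mul] the signs of the inverted pairs cancel, and those of the
   pairs kept in order remain. *)
Fixpoint shuf_rec s f g : K :=
  if s is x :: s' then
    shuf_rec s' (dl x f) (tw (tag x) g) + shuf_rec s' f (dl x g)
  else f [::] * g [::].

Definition shuf_mul f g : shuf := fun s => shuf_rec s f g.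
Definition shuf_one : shuf := fun s => (s == [::])%:R.

Lemma shufDE f g s : (f + g) s = f s + g s. Proof. by []. Qed.
Lemma shufNE f s : (- f) s = - f s. Proof. by []. Qed.
Lemma shuf0E s : (0 : shuf) s = 0. Proof. by []. Qed.

Lemma dlD x f g : dl x (f + g) = dl x f + dl x g. Proof. by []. Qed.
Lemma drD x f g : dr x (f + g) = dr x f + dr x g. Proof. by []. Qed.
Lemma twD k f g : tw k (f + g) = tw k f + tw k g.
Proof. by apply/funext=> s; rewrite /tw shufDE mulrDr. Qed.

Lemma deg_cons x s : deg (x :: s) = tag x + deg s.
Proof. by rewrite /deg big_cons. Qed.
Lemma deg_nil : deg ([::] : seq (homog E)) = 0.
Proof. by rewrite /deg big_nil. Qed.
Lemma deg_cat s t : deg (s ++ t) = deg s + deg t.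
Proof. by rewrite /deg big_cat. Qed.
Lemma deg_rcons s x : deg (rcons s x) = deg s + tag x.
Proof. by rewrite -cats1 deg_cat deg_cons deg_nil addr0. Qed.

Lemma dl_tw x k f : dl x (tw k f) = shuf_scale (sg K (k * tag x)) (tw k (dl x f)).
Proof.
by apply/funext=> s; rewrite /dl /tw /shuf_scale deg_cons mulrDr sgD mulrA.
Qed.

Lemma shuf_recDl s f f' g :
  shuf_rec s (f + f') g = shuf_rec s f g + shuf_rec s f' g.
Proof.
elim: s f f' g => [|x s IH] f f' g /=; first by rewrite shufDE mulrDl.
by rewrite dlD !IH addrACA.
Qed.

Lemma shuf_recDr s f g g' :
  shuf_rec s f (g + g') = shuf_rec s f g + shuf_rec s f g'.
Proof.
elim: s f g g' => [|x s IH] f g g' /=; first by rewrite shufDE mulrDr.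
by rewrite dlD twD !IH addrACA.
Qed.

Lemma dl_scale x a f : dl x (shuf_scale a f) = shuf_scale a (dl x f).
Proof. by []. Qed.

Lemma shuf_recZl s a f g : shuf_rec s (shuf_scale a f) g = a * shuf_rec s f g.
Proof.
elim: s f g => [|x s IH] f g /=; first by rewrite mulrA.
by rewrite dl_scale !IH mulrDr.
Qed.

Lemma tw_scale k a f : tw k (shuf_scale a f) = shuf_scale a (tw k f).
Proof. by apply/funext=> s; rewrite /tw /shuf_scale mulrCA. Qed.

Lemma shuf_recZr s a f g : shuf_rec s f (shuf_scale a g) = a * shuf_rec s f g.
Proof.
elim: s f g => [|x s IH] f g /=; first by rewrite mulrCA.
by rewrite dl_scale tw_scale !IH mulrDr.
Qed.

Lemma twtw k l f : tw k (tw l f) = tw l (tw k f).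
Proof. by apply/funext=> s; rewrite /tw mulrCA. Qed.

Lemma twE_rec s k f g :
  shuf_rec s (tw k f) (tw k g) = sg K (k * deg s) * shuf_rec s f g.
Proof.
elim: s f g => [|x s IH] f g /=.
  by rewrite /tw deg_nil mulr0 sg0 !mul1r.
rewrite !dl_tw !(shuf_recZl, shuf_recZr) [tw _ (tw _ _)]twtw !IH deg_cons.
by rewrite (mulrDr k) sgD; ring.
Qed.

Lemma tw_mul k f g : tw k (shuf_mul f g) = shuf_mul (tw k f) (tw k g).
Proof. by apply/funext=> s; rewrite /shuf_mul twE_rec. Qed.

Lemma dl_mul x f g :
  dl x (shuf_mul f g) = shuf_mul (dl x f) (tw (tag x) g) + shuf_mul f (dl x g).
Proof. by []. Qed.

Let mulDl : left_distributive shuf_mul +%R.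
Proof. by move=> f g h; apply/funext=> s; apply: shuf_recDl. Qed.
Let mulDr : right_distributive shuf_mul +%R.
Proof. by move=> f g h; apply/funext=> s; apply: shuf_recDr. Qed.

(** Under [dl x] both bracketings give the same three terms, because [tw] is multiplicative. *)
Let mulA : associative shuf_mul.
Proof.
move=> f g h; apply/funext=> s; elim: s f g h => [|x s IH] f g h.
  exact: mulrA.
rewrite -[LHS]/(dl x _ s) -[RHS]/(dl x _ s) !dl_mul tw_mul mulDl mulDr.
by rewrite !shufDE !IH addrA.
Qed.

Lemma dl_one x : dl x shuf_one = 0. Proof. by []. Qed.

Lemma dl_zero x : dl x 0 = 0. Proof. by []. Qed.
Lemma shuf_rec0l s g : shuf_rec s 0 g = 0.
Proof.
by elim: s g => [|x s IH] g /=; rewrite ?mul0r // dl_zero !IH addr0.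
Qed.
Lemma tw_zero k : tw k 0 = 0.
Proof. by apply/funext=> s; rewrite /tw mulr0. Qed.
Lemma shuf_rec0r s f : shuf_rec s f 0 = 0.
Proof.
by elim: s f => [|x s IH] f /=; rewrite ?mulr0 // dl_zero tw_zero !IH addr0.
Qed.
Lemma tw_one k : tw k shuf_one = shuf_one.
Proof.
apply/funext=> -[|x s]; rewrite /tw /shuf_one /= ?mulr0 //.
by rewrite deg_nil mulr0 mulr1.
Qed.

Let mul1 : left_id shuf_one shuf_mul.
Proof.
move=> f; apply/funext=> s; elim: s f => [|x s IH] f.
  exact: mul1r.
by rewrite -[LHS]/(dl x _ s) dl_mul shufDE dl_one IH {1}/shuf_mul shuf_rec0l add0r.
Qed.
Let mulr1' : right_id shuf_one shuf_mul.
Proof.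
move=> f; apply/funext=> s; elim: s f => [|x s IH] f.
  exact: mulr1.
rewrite -[LHS]/(dl x _ s) dl_mul shufDE dl_one tw_one IH.
by rewrite {1}/shuf_mul shuf_rec0r addr0.
Qed.

Let one_neq0 : shuf_one != 0.
Proof.
apply/eqP=> /(congr1 (fun f : shuf => f [::])) /eqP.
by rewrite /shuf_one eqxx oner_eq0.
Qed.

HB.instance Definition _ := GRing.Zmodule_isNzRing.Build shuf
  mulA mul1 mulr1' mulDl mulDr one_neq0.

Let scaleA a b f : shuf_scale a (shuf_scale b f) = shuf_scale (a * b) f.
Proof. by apply/funext=> s; apply: mulrA. Qed.
Let scale1 : left_id 1 shuf_scale.
Proof. by move=> f; apply/funext=> s; apply: mul1r. Qed.
Let scaleDr : right_distributive shuf_scale +%R.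
Proof. by move=> a f g; apply/funext=> s; apply: mulrDr. Qed.
Let scaleDl f : {morph shuf_scale^~ f : a b / a + b}.
Proof. by move=> a b; apply/funext=> s; apply: mulrDl. Qed.

HB.instance Definition _ := GRing.Zmodule_isLmodule.Build K shuf
  scaleA scale1 scaleDr scaleDl.

Let scaleAl (a : K) f g : a *: (f * g) = (a *: f) * g.
Proof. by apply/funext=> s; symmetry; apply: shuf_recZl. Qed.
Let scaleAr (a : K) f g : a *: (f * g) = f * (a *: g).
Proof. by apply/funext=> s; symmetry; apply: shuf_recZr. Qed.

HB.instance Definition _ := GRing.Lmodule_isLalgebra.Build K shuf scaleAl.
HB.instance Definition _ := GRing.Lalgebra_isAlgebra.Build K shuf scaleAr.

End ShuffleAlgebra.

Section ShuffleTheory.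
Variables (K : numFieldType) (E : gradedVect K).
Local Notation W := (shuf E).
Implicit Types (f g h : W) (s : seq (homog E)) (x y : homog E) (n m k : int).

Lemma shuf_mul_nil f g : (f * g) [::] = f [::] * g [::].
Proof. by []. Qed.

Lemma shuf_mul_cons x s f g :
  (f * g) (x :: s) = (dl x f * tw (tag x) g) s + (f * dl x g) s.
Proof. by []. Qed.

Lemma shufZE (a : K) f s : (a *: f) s = a * f s.
Proof. by []. Qed.

Lemma shuf_sumE (I : Type) (r : seq I) (P : pred I) (F : I -> W) s :
  (\sum_(i <- r | P i) F i) s = \sum_(i <- r | P i) F i s.
Proof. by elim/big_rec2: _ => // i a f _ <-. Qed.

Lemma shuf1E s : (1 : W) s = (s == [::])%:R.
Proof. by []. Qed.

Lemma drZ x (a : K) f : dr x (a *: f) = a *: dr x f. Proof. by []. Qed.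
(** The last letter has no letter after it: in the first factor it costs no sign, and in the second
    it is signed against every letter of the first, whence [tw]. *)
Lemma dr_mul x f g : dr x (f * g) = dr x f * g + tw (tag x) f * dr x g.
Proof.
apply/funext=> s; elim: s f g => [|y s IH] f g.
  rewrite {1}/dr /= shuf_mul_cons !shufDE !shuf_mul_nil /dr /dl /tw /=.
  by rewrite deg_nil !mulr0 sg0 !mul1r.
have IHx (u v : W) : (u * v) (rcons s x) = (dr x u * v) s + (tw (tag x) u * dr x v) s.
  rewrite -shufDE. by rewrite -IH.
rewrite -[LHS]/((f * g) (y :: rcons s x)) shuf_mul_cons !IHx.
rewrite shufDE !shuf_mul_cons.
have E1 : dr x (tw (tag y) g) = sg K (tag y * tag x) *: tw (tag y) (dr x g).
  apply/funext=> t; rewrite /dr /tw shufZE deg_rcons mulrDr sgD; ring.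
have E2 : dl y (tw (tag x) f) = sg K (tag x * tag y) *: tw (tag x) (dl y f).
  by rewrite dl_tw.
rewrite E1 E2 -scalerAr -scalerAl !shufZE [tag y * tag x]mulrC.
rewrite (_ : dr x (dl y f) = dl y (dr x f)) //.
rewrite (_ : dr x (dl y g) = dl y (dr x g)) //.
by rewrite addrACA.
Qed.

Definition hdeg n f : Prop := forall s, deg s != - n -> f s = 0.

Lemma dl_twE x k f : dl x (tw k f) = sg K (k * tag x) *: tw k (dl x f).
Proof. exact: dl_tw. Qed.

Lemma hdeg_dl n x f : hdeg n f -> hdeg (n + tag x) (dl x f).
Proof.
move=> hf s hs; apply: hf; apply: contraNN hs; rewrite deg_cons; lia.
Qed.

Lemma hdeg_dr n x f : hdeg n f -> hdeg (n + tag x) (dr x f).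
Proof.
move=> hf s hs; apply: hf; apply: contraNN hs; rewrite deg_rcons; lia.
Qed.

Lemma hdegD n f g : hdeg n f -> hdeg n g -> hdeg n (f + g).
Proof. by move=> hf hg s hs; rewrite shufDE hf // hg // addr0. Qed.

Lemma hdegZ n a f : hdeg n f -> hdeg n (a *: f).
Proof. by move=> hf s hs; rewrite shufZE hf // mulr0. Qed.

Lemma hdegN n f : hdeg n f -> hdeg n (- f).
Proof. by move=> hf s hs; rewrite shufNE hf // oppr0. Qed.

Lemma hdeg0 n : hdeg n 0.
Proof. by []. Qed.

Lemma hdeg1 : hdeg 0 1.
Proof. by case=> // /eqP[]; rewrite deg_nil oppr0. Qed.

Lemma hdeg_sum n (I : Type) (r : seq I) (P : pred I) (F : I -> W) :
  (forall i, P i -> hdeg n (F i)) -> hdeg n (\sum_(i <- r | P i) F i).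
Proof. by move=> hF; elim/big_ind: _ => //; apply: hdegD. Qed.

Lemma tw_hdeg n k f : hdeg n f -> tw k f = sg K (k * n) *: f.
Proof.
move=> hf; apply/funext=> s; rewrite /tw shufZE.
have [->|/hf ->] := eqVneq (deg s) (- n); last by rewrite !mulr0.
by rewrite mulrN sgN.
Qed.

Lemma hdegM n m f g : hdeg n f -> hdeg m g -> hdeg (n + m) (f * g).
Proof.
move=> hf hg s; elim: s n m f g hf hg => [|x s IH] n m f g hf hg hs.
  rewrite shuf_mul_nil; have [n0|n0] := eqVneq n 0.
    by rewrite hg ?mulr0 // deg_nil; apply: contraNN hs; rewrite deg_nil; lia.
  by rewrite hf ?mul0r // deg_nil; apply: contraNN n0; lia.
rewrite shuf_mul_cons (tw_hdeg _ hg) -scalerAr shufZE.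
rewrite (IH _ _ _ _ (hdeg_dl (x := x) hf) hg); last first.
  by apply: contraNN hs; rewrite deg_cons; lia.
rewrite (IH _ _ _ _ hf (hdeg_dl (x := x) hg)) ?mulr0 ?addr0 //.
by apply: contraNN hs; rewrite deg_cons; lia.
Qed.

(** The two terms of the recursion trade places when the factors do. *)
Lemma mulC_hdeg n m f g : hdeg n f -> hdeg m g -> f * g = sg K (n * m) *: (g * f).
Proof.
move=> hf hg; apply/funext=> s; elim: s n m f g hf hg => [|x s IH] n m f g hf hg.
  rewrite shufZE !shuf_mul_nil.
  have [->|n0] := eqVneq n 0; first by rewrite mul0r sg0 mul1r mulrC.
  by rewrite hf ?(mul0r, mulr0) // deg_nil; apply: contraNN n0; lia.
rewrite shufZE !shuf_mul_cons (tw_hdeg _ hg) (tw_hdeg _ hf) -!scalerAr !shufZE.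
rewrite (IH _ _ _ _ (hdeg_dl (x := x) hf) hg).
rewrite (IH _ _ _ _ hf (hdeg_dl (x := x) hg)) !shufZE.
rewrite !mulrDl !mulrDr !sgD [n * tag x]mulrC.
by rewrite addrC -!mulrA; congr (_ + _); rewrite [RHS]mulrC mulrCA sgsqK mulrC.
Qed.

(** The decreasing filtration by arity. It stands in for a topology on formal sums: a cochain in all
    of its steps is zero. *)
Definition vanish (m : nat) f : Prop := forall s, (size s < m)%N -> f s = 0.

Lemma vanish0 f : vanish 0 f. Proof. by []. Qed.

Lemma vanish1 f : f [::] = 0 -> vanish 1 f.
Proof. by move=> f0 [|]. Qed.

Lemma vanishD (m : nat) f g : vanish m f -> vanish m g -> vanish m (f + g).
Proof. by move=> hf hg s hs; rewrite shufDE hf // hg // addr0. Qed.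

Lemma vanishZ (m : nat) a f : vanish m f -> vanish m (a *: f).
Proof. by move=> hf s hs; rewrite shufZE hf // mulr0. Qed.

Lemma vanish_sum (m : nat) (I : Type) (r : seq I) (P : pred I) (F : I -> W) :
  (forall i, P i -> vanish m (F i)) -> vanish m (\sum_(i <- r | P i) F i).
Proof. by move=> hF; elim/big_ind: _ => //; apply: vanishD. Qed.

Lemma vanish_tw (m : nat) k f : vanish m f -> vanish m (tw k f).
Proof. by move=> hf s hs; rewrite /tw hf // mulr0. Qed.

Lemma vanishM (m p : nat) f g : vanish m f -> vanish p g -> vanish (m + p) (f * g).
Proof.
move=> hf hg s; elim: s m p f g hf hg => [|x s IH] m p f g hf hg /= hs.
  rewrite shuf_mul_nil; case: m hf hs => [|m] hf hs.
    by rewrite hg ?mulr0.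
  by rewrite hf ?mul0r.
rewrite shuf_mul_cons (IH m.-1 p (dl x f)) ?(IH m p.-1 f) ?addr0 //; try lia.
- by case: p hg {hs} => // p hg t ht; apply: hg.
- by case: m hf {hs} => // m hf t ht; apply: hf.
- exact: vanish_tw.
Qed.

(* Graded symmetry is imposed on adjacent transpositions only; unlike in
   [is_function], a constant term is allowed. *)
Record symf f : Prop := Symf {
  symf_linear : forall s1 s2 (i : int) (a : K) (u v : E i),
    f (s1 ++ hom_of (a *: u + v) :: s2) =
      a * f (s1 ++ hom_of u :: s2) + f (s1 ++ hom_of v :: s2);
  symf_swap : forall s1 s2 x y,
    f (s1 ++ y :: x :: s2) = sg K (tag x * tag y) * f (s1 ++ x :: y :: s2)
}.

Lemma symf0 : symf 0.
Proof. by split=> *; rewrite !shuf0E !mulr0 ?addr0. Qed.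

Lemma symf1 : symf 1.
Proof. by split=> [[|? ?]|[|? ?]] *; rewrite !shuf1E !mulr0 ?addr0. Qed.

Lemma symfD f g : symf f -> symf g -> symf (f + g).
Proof.
move=> hf hg; split=> *; rewrite !shufDE.
  by rewrite (symf_linear hf) (symf_linear hg); ring.
by rewrite (symf_swap hf) (symf_swap hg); ring.
Qed.

Lemma symfZ a f : symf f -> symf (a *: f).
Proof.
move=> hf; split=> *; rewrite !shufZE.
  by rewrite (symf_linear hf); ring.
by rewrite (symf_swap hf); ring.
Qed.

Lemma symfN f : symf f -> symf (- f).
Proof. by rewrite -scaleN1r; apply: symfZ. Qed.

Lemma symfB f g : symf f -> symf g -> symf (f - g).
Proof. by move=> hf hg; apply: symfD => //; apply: symfN. Qed.

Lemma symf_sum (I : Type) (r : seq I) (P : pred I) (F : I -> W) :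
  (forall i, P i -> symf (F i)) -> symf (\sum_(i <- r | P i) F i).
Proof. by move=> hF; elim/big_ind: _ => //; [apply: symf0|apply: symfD]. Qed.

Lemma symf_dl x f : symf f -> symf (dl x f).
Proof.
by move=> hf; split=> s1 *; rewrite /dl -!cat_cons;
  [apply: (symf_linear hf)|apply: (symf_swap hf)].
Qed.

Lemma symf_dr x f : symf f -> symf (dr x f).
Proof.
by move=> hf; split=> s1 *; rewrite /dr !rcons_cat;
  [apply: (symf_linear hf)|apply: (symf_swap hf)].
Qed.

Lemma symf_tw k f : symf f -> symf (tw k f).
Proof.
move=> hf; split=> [s1 s2 i a u v|s1 s2 x y]; rewrite /tw !deg_cat !deg_cons.
  by rewrite (symf_linear hf); ring.
by rewrite (symf_swap hf) (addrCA (tag y)); ring.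
Qed.

Lemma symf_weight (c : nat -> K) f :
  symf f -> symf (fun s => c (size s) * f s).
Proof.
move=> hf; split=> [s1 s2 i a u v|s1 s2 x y]; rewrite !size_cat /=.
  by rewrite (symf_linear hf); ring.
by rewrite (symf_swap hf); ring.
Qed.

Lemma dl_lin (i : int) (a : K) (u v : E i) f : symf f ->
  dl (hom_of (a *: u + v)) f = a *: dl (hom_of u) f + dl (hom_of v) f.
Proof. by move=> hf; apply/funext=> s; apply: (symf_linear hf [::]). Qed.

Lemma dl_swap x y f : symf f -> dl x (dl y f) = sg K (tag x * tag y) *: dl y (dl x f).
Proof. by move=> hf; apply/funext=> s; apply: (symf_swap hf [::]). Qed.

Lemma symf_zero f s1 s2 (i : int) : symf f -> f (s1 ++ hom_of (0 : E i) :: s2) = 0.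
Proof.
move=> hf; have := symf_linear hf s1 s2 1 (0 : E i) 0.
by rewrite scaler0 addr0 mul1r => /eqP; rewrite -subr_eq subrr eq_sym => /eqP.
Qed.

(** The recursion reduces to words that begin with the letters in question. For the exchange, terms
    with both letters in one factor use the symmetry of that factor, and the two terms that separate
    the letters trade places. *)
Lemma symfM f g : symf f -> symf g -> symf (f * g).
Proof.
move=> hf hg; split.
  move=> s1 s2 i a u v; elim: s1 f g hf hg => [|z s1 IH] f g hf hg; last first.
    rewrite !cat_cons !shuf_mul_cons !IH //; try exact: symf_dl; try exact: symf_tw.
    by ring.
  rewrite /= !shuf_mul_cons !dl_lin // !(mulrDl, mulrDr) -scalerAl -scalerAr.
  by rewrite !(shufDE, shufZE); ring.
move=> s1 s2 x y; elim: s1 f g hf hg => [|z s1 IH] f g hf hg; last first.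
  rewrite !cat_cons !shuf_mul_cons !IH //; try exact: symf_dl; try exact: symf_tw.
  by ring.
rewrite /= !shuf_mul_cons !dl_twE -!scalerAr !shufZE.
rewrite !(dl_swap x y) // -scalerAl -scalerAr !shufZE.
rewrite [tw (tag y) (tw _ _)]twtw (mulrC (tag y)).
have := sgsq K (tag x * tag y); move: (sg K _) => c cc.
move: (_ s2) (_ s2) (_ s2) (_ s2) => p q r t.
rewrite !mulrDr !(mulrA c) cc. ring.
Qed.

Lemma symf_rcons x s f : symf f -> f (x :: s) = sg K (tag x * deg s) * f (rcons s x).
Proof.
move=> hf; rewrite -[x :: s]cat0s -[rcons s x]cat0s.
elim: s [::] => [|y s IH] s1; first by rewrite deg_nil mulr0 sg0 mul1r.
rewrite (symf_swap hf) -cat_rcons IH deg_cons mulrDr sgD cat_rcons rcons_cons.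
by rewrite [tag y * _]mulrC mulrA.
Qed.

End ShuffleTheory.

(** * Comparison with functions and their product *)

Section Permutations.
Variables (K : numFieldType) (E : gradedVect K).
Local Notation W := (shuf E).
Local Notation T := (homog E).

Definition hom0 : T := @hom_of K E 0 0.

Section FixedWord.
Variable s : seq T.

Let dg (i : nat) : int := tag (nth hom0 s i).

(** [koszul] for a list of positions in place of a permutation, which can be peeled one entry at a
    time. *)
Fixpoint kos (w : seq nat) : K :=
  if w is a :: w' then (\prod_(b <- w' | (b < a)%N) sg K (dg a * dg b)) * kos w'
  else 1.

Lemma kosE w : kos w = \prod_(a < size w) \prod_(b < size w |
   ((a < b) && (nth 0 w b < nth 0 w a))%N) sg K (dg (nth 0 w a) * dg (nth 0 w b)).
Proof.
elim: w => [|a w IH] /=; first by rewrite big_ord0.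
rewrite big_ord_recl /=; congr (_ * _).
  by rewrite [RHS]big_mkcond big_ord_recl /= mul1r (big_nth 0%N) big_mkord big_mkcond.
rewrite IH; apply: eq_bigr => i _.
by rewrite [RHS]big_mkcond big_ord_recl /= mul1r -big_mkcond.
Qed.

Definition word_of (sigma : 'S_(size s)) : seq nat :=
  [seq val (sigma a) | a <- enum 'I_(size s)].

Lemma size_word_of sigma : size (word_of sigma) = size s.
Proof. by rewrite size_map size_enum_ord. Qed.

Lemma nth_word_of sigma (a : 'I_(size s)) : nth 0 (word_of sigma) a = sigma a.
Proof. by rewrite (nth_map a) ?size_enum_ord // nth_ord_enum. Qed.

Lemma word_of_inj : injective word_of.
Proof.
move=> sigma tau e; apply/permP => a; apply: val_inj.
by rewrite /= -!nth_word_of e.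
Qed.

Lemma perm_word_of sigma : perm_eq (word_of sigma) (iota 0 (size s)).
Proof.
apply: uniq_perm; rewrite ?iota_uniq //.
  by rewrite map_inj_uniq ?enum_uniq // => a b /val_inj/perm_inj.
move=> i; rewrite mem_iota /= add0n; apply/mapP/idP => [[a _ ->]|hi].
  exact: ltn_ord.
by exists (sigma^-1 (Ordinal hi))%g; rewrite ?mem_enum // permKV.
Qed.

Lemma permuteE sigma : permute sigma = map (nth hom0 s) (word_of sigma).
Proof.
by rewrite -map_comp; apply: eq_map => a; rewrite /= (tnth_nth hom0).
Qed.

Lemma koszulE sigma : koszul sigma = kos (word_of sigma).
Proof.
rewrite kosE size_word_of; apply: eq_bigr => a _.
apply: eq_big => [b|b _]; rewrite !nth_word_of //.
by rewrite !(tnth_nth hom0).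
Qed.

Lemma word_ofP w : perm_eq w (iota 0 (size s)) -> {sigma | word_of sigma = w}.
Proof.
move=> pw; have szw : size w = size s by rewrite (perm_size pw) size_iota.
have lt_w (a : 'I_(size s)) : (nth 0 w a < size s)%N.
  have : nth 0 w a \in w by rewrite mem_nth // szw.
  by rewrite (perm_mem pw) mem_iota.
have inj_w : injective (fun a => Ordinal (lt_w a)).
  move=> a b [/eqP]; rewrite nth_uniq ?szw //; first by move/eqP/val_inj.
  by rewrite (perm_uniq pw) iota_uniq.
exists (perm inj_w); apply: (@eq_from_nth _ 0%N); rewrite size_word_of // => i hi.
by rewrite (nth_word_of _ (Ordinal hi)) permE.
Qed.

(** Insertion sort exchanges adjacent entries once for each inversion; this turns symmetry under
    adjacent exchanges into symmetry under all permutations, with the sign [kos]. *)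
Fixpoint ins (a : nat) (v : seq nat) : seq nat :=
  if v is b :: v' then if (b < a)%N then b :: ins a v' else a :: v else [:: a].

Lemma perm_ins a v : perm_eq (ins a v) (a :: v).
Proof.
elim: v => //= b v IH; case: ifP => // _.
rewrite (perm_trans (y := b :: a :: v)) ?perm_cons //.
exact/permPl/(perm_catCA [:: b] [:: a] v).
Qed.

Lemma sorted_ins a v : sorted leq v -> sorted leq (ins a v).
Proof.
elim: v => //= b v IH hv; case: ltnP => [lt_ba|le_ab] /=; last by rewrite le_ab.
have := IH (path_sorted hv); rewrite (path_sortedE leq_trans) => ->.
rewrite andbT (perm_all _ (perm_ins a v)) /= (ltnW lt_ba).
exact: order_path_min leq_trans hv.
Qed.

Lemma symf_ins (f : W) pre a v : symf f -> sorted leq v ->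
  f (pre ++ map (nth hom0 s) (a :: v)) =
  (\prod_(b <- v | (b < a)%N) sg K (dg a * dg b)) *
    f (pre ++ map (nth hom0 s) (ins a v)).
Proof.
move=> hf; elim: v pre => [|b v IH] pre hv; first by rewrite big_nil mul1r.
rewrite big_cons /=; case: ltnP => [lt_ba|le_ab].
  rewrite (symf_swap hf) -cat_rcons (IH _ (path_sorted hv)).
  by rewrite [dg a * dg b]mulrC mulrA -cat_rcons.
rewrite big_seq_cond big1 ?mul1r // => c /andP[cv].
have := allP (order_path_min leq_trans hv) c cv => le_bc.
by rewrite ltnNge (leq_trans le_ab le_bc).
Qed.

Lemma symf_word (f : W) w : symf f ->
  f (map (nth hom0 s) w) = kos w * f (map (nth hom0 s) (foldr ins [::] w)).
Proof.
move=> hf; have hs w' : sorted leq (foldr ins [::] w').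
  by elim: w' => //= b w' IH; apply: sorted_ins.
have hp w' : perm_eq (foldr ins [::] w') w'.
  elim: w' => //= b w' IH; rewrite (perm_trans (perm_ins _ _)) //.
  by rewrite perm_cons.
suff /(_ [::]): forall pre, f (pre ++ map (nth hom0 s) w) =
  kos w * f (pre ++ map (nth hom0 s) (foldr ins [::] w)) by [].
elim: w => [|a w IH] pre; first by rewrite mul1r.
rewrite [kos _]/= [foldr _ _ _]/= -(perm_big _ (hp w)) /= mulrAC -symf_ins //.
by rewrite /= -cat_rcons IH cat_rcons mulrC.
Qed.

Lemma symf_permute (f : W) (sigma : 'S_(size s)) : symf f -> f (permute sigma) = koszul sigma * f s.
Proof.
move=> hf; rewrite permuteE koszulE (symf_word _ hf); congr (_ * f _).
suff -> : foldr ins [::] (word_of sigma) = iota 0 (size s).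
  by rewrite -[RHS](mkseq_nth hom0).
apply: (sorted_eq leq_trans anti_leq).
- by elim: (word_of sigma) => //= b w' IH; apply: sorted_ins.
- exact: iota_sorted.
- apply: perm_trans (perm_word_of sigma).
  elim: (word_of sigma) => //= b w' IH; rewrite (perm_trans (perm_ins _ _)) //.
  by rewrite perm_cons.
Qed.

Lemma kos_cat u v : kos (u ++ v) =
  kos u * kos v * \prod_(a <- u) \prod_(b <- v | (b < a)%N) sg K (dg a * dg b).
Proof.
elim: u => [|a u IH] /=; first by rewrite big_nil mulr1 mul1r.
by rewrite big_cons big_cat IH /=; ring.
Qed.

Lemma kos_sorted u : sorted ltn u -> kos u = 1.
Proof.
elim: u => //= a u IH hu; rewrite (IH (path_sorted hu)) mulr1.
rewrite big_seq_cond big1 // => b /andP[bu].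
have /allP/(_ b bu) := order_path_min ltn_trans hu.
by rewrite /= ltnNge => /negP h /ltnW /h.
Qed.

End FixedWord.

(** The transposition of two adjacent positions has a single inversion, so its [koszul] is the sign
    of [symf_swap]. *)
Lemma is_function_symf (f : W) : is_function f -> symf f.
Proof.
case=> f0 flin fsym; split=> // s1 s2 x y; set s := s1 ++ x :: y :: s2.
pose k := size s1; pose m := size s2.
pose w := iota 0 k ++ [:: k.+1; k] ++ iota k.+2 m.
have szs : size s = (k + m.+2)%N by rewrite size_cat.
have iotaE : iota 0 (size s) = iota 0 k ++ [:: k; k.+1] ++ iota k.+2 m.
  by rewrite szs iotaD.
have pw : perm_eq w (iota 0 (size s)).
  by rewrite iotaE perm_cat2l; exact/permPl/(perm_catCA [:: k.+1] [:: k]).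
have [sigma hw] := word_ofP pw.
have := fsym s sigma; rewrite permuteE koszulE hw => e.
have Ex : nth hom0 s k = x by rewrite nth_cat ltnn subnn.
have Ey : nth hom0 s k.+1 = y by rewrite nth_cat ltnNge leqnSn /= subSnn.
have E1 : map (nth hom0 s) (iota 0 k) = s1.
  apply: (@eq_from_nth _ hom0); rewrite size_map size_iota // => i hi.
  by rewrite (nth_map 0%N) ?size_iota // nth_iota // nth_cat hi.
have E2 : map (nth hom0 s) (iota k.+2 m) = s2.
  apply: (@eq_from_nth _ hom0); rewrite size_map size_iota // => i hi.
  rewrite (nth_map 0%N) ?size_iota // nth_iota // nth_cat -/k ifF; last by lia.
  by rewrite (_ : (k.+2 + i - k)%N = i.+2) //; lia.
move: e; rewrite !map_cat /= E1 E2 Ex Ey => ->; congr (_ * _).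
have K2 : kos s [:: k.+1; k] = sg K (tag x * tag y).
  by rewrite /= big_cons ltnSn !big_nil !mulr1 Ex Ey mulrC.
rewrite !kos_cat K2 !(@kos_sorted _ (iota _ _)) ?iota_ltn_sorted //.
rewrite mul1r mulr1 !big1_seq ?mulr1 //.
- move=> a; rewrite mem_iota add0n => /andP[_ /andP[_ ak]].
  rewrite big_seq_cond big1 // => b; rewrite !inE mem_iota.
  move=> /andP[+ ba]; lia.
- move=> a; rewrite !inE => /andP[_ ak].
  rewrite big_seq_cond big1 // => b; rewrite mem_iota.
  move=> /andP[+ ba]; lia.
Qed.

Lemma is_functionP (f : W) : is_function f <-> symf f /\ f [::] = 0.
Proof.
split=> [hf|[hf f0]]; first by split; [exact: is_function_symf|case: hf].
split=> // [s1 s2 i a u v|s sigma]; first exact: (symf_linear hf).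
exact: symf_permute.
Qed.

End Permutations.

Section Shuffles.
Variables (K : numFieldType) (E : gradedVect K).
Local Notation W := (shuf E).
Local Notation T := (homog E).
Local Notation hom0 := (@hom0 K E).

(** A shuffle is determined by the set of its first p values, encoded as a mask with p entries
    [true]. Unlike permutations, masks follow the recursion of the product. *)
Fixpoint masks (n : nat) : seq bitseq :=
  if n is n'.+1 then map (cons true) (masks n') ++ map (cons false) (masks n')
  else [:: [::]].

Lemma mem_masks n m : (m \in masks n) = (size m == n).
Proof.
elim: n m => [|n IH] m /=; first by rewrite inE size_eq0.
rewrite mem_cat; case: m => [|b m] /=.
  by apply/orP => -[] /mapP[].
rewrite eqSS -IH; case: b.
  rewrite mem_map; last by move=> ? ? [].
  by case: (m \in _) => //=; apply/mapP => -[].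
rewrite orbC mem_map; last by move=> ? ? [].
by case: (m \in _) => //=; apply/mapP => -[].
Qed.

Lemma uniq_masks n : uniq (masks n).
Proof.
elim: n => //= n IH; rewrite cat_uniq !map_inj_uniq ?IH //=; try by move=> ? ? [].
by rewrite andbT; apply/hasPn => m /mapP[? _ ->]; apply/mapP => -[].
Qed.

(** One sign for each pair formed by a selected letter and a later unselected one. *)
Fixpoint mask_sign (m : bitseq) (s : seq T) : K :=
  match m, s with
  | true :: m', x :: s' =>
      sg K (tag x * deg (mask (map negb m') s')) * mask_sign m' s'
  | false :: m', _ :: s' => mask_sign m' s'
  | _, _ => 1
  end.

Lemma mulE_masks (f g : W) s : (f * g) s =
  \sum_(m <- masks (size s))
     mask_sign m s * (f (mask m s) * g (mask (map negb m) s)).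
Proof.
elim: s f g => [|x s IH] f g; first by rewrite big_seq1 mul1r.
rewrite shuf_mul_cons big_cat !big_map !IH; congr (_ + _).
by apply: eq_bigr => m _; rewrite /= /tw /dl; ring.
Qed.

Lemma perm_mask_negb (X : eqType) (m : bitseq) (s : seq X) : size m = size s ->
  perm_eq (mask m s ++ mask (map negb m) s) s.
Proof.
move=> sz; apply/seq.permP => a; rewrite count_cat; move: sz.
by elim: m s => [|[] m IH] [|x s] //= [/IH <-]; rewrite -?addnA // addnCA.
Qed.

Section Unshuffle.
Variable s : seq T.
Local Notation n := (size s).
Let dg (i : nat) : int := tag (nth hom0 s i).

Definition mask_word (m : bitseq) : seq nat :=
  mask m (iota 0 n) ++ mask (map negb m) (iota 0 n).

Lemma mask_wordP (m : n.-tuple bool) : perm_eq (mask_word m) (iota 0 n).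
Proof. by apply: perm_mask_negb; rewrite size_tuple size_iota. Qed.

Definition perm_of_mask (m : n.-tuple bool) : 'S_n := sval (word_ofP (mask_wordP m)).

Lemma word_of_mask m : word_of (perm_of_mask m) = mask_word m.
Proof. exact: (svalP (word_ofP (mask_wordP m))). Qed.

Definition mask_of_perm (p : nat) (sigma : 'S_n) : n.-tuple bool :=
  map_tuple (fun i => ((sigma^-1)%g i < p)%N) (ord_tuple n).

Lemma nth_mask_of_perm p sigma (i : 'I_n) :
  nth false (mask_of_perm p sigma) i = ((sigma^-1)%g i < p)%N.
Proof. by rewrite (nth_map i) ?size_enum_ord // nth_ord_enum. Qed.

Lemma mem_mask_iota (m : n.-tuple bool) (i : 'I_n) :
  (nat_of_ord i \in mask m (iota 0 n)) = nth false m i.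
Proof.
rewrite in_mask ?iota_uniq // mem_iota /= add0n ltn_ord /=; congr nth.
by rewrite -{1}[nat_of_ord i](nth_iota 0 0 (ltn_ord i)) index_uniq ?iota_uniq ?size_iota.
Qed.

Lemma count_mask (m : n.-tuple bool) : count id m = size (mask m (iota 0 n)).
Proof. by rewrite size_mask // size_tuple size_iota. Qed.

Lemma count_mask_le (m : n.-tuple bool) : (count id m < n.+1)%N.
Proof. by rewrite ltnS -[X in (_ <= X)%N](size_tuple m) count_size. Qed.

Lemma sorted_mask_iota (m : bitseq) : sorted ltn (mask m (iota 0 n)).
Proof. apply: sorted_mask (iota_ltn_sorted _ _); exact: ltn_trans. Qed.

Lemma shuffle_of_mask (m : n.-tuple bool) : shuffle (count id m) (perm_of_mask m).
Proof.
apply/forallP => a; apply/forallP => b; apply/implyP => /andP[ab hab].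
rewrite -!nth_word_of word_of_mask /mask_word !nth_cat -count_mask.
have szb : size (mask (map negb m) (iota 0 n)) = (n - count id m)%N.
  have := perm_size (mask_wordP m); rewrite size_cat -count_mask size_iota => e.
  by rewrite -[X in (X - _)%N]e addKn.
case/orP: hab => h.
  rewrite (ltn_trans ab h) h; apply: (sorted_ltn_nth ltn_trans) => //.
  - exact: sorted_mask_iota.
  - by rewrite inE -count_mask (ltn_trans ab).
  - by rewrite inE -count_mask.
have := ltn_ord a; have := ltn_ord b => hb ha.
rewrite !ifF; try lia.
apply: (sorted_ltn_nth ltn_trans); first exact: sorted_mask_iota.
- by rewrite inE szb; lia.
- by rewrite inE szb; lia.
- by lia.
Qed.

Lemma perm_of_maskK (m : n.-tuple bool) :
  mask_of_perm (count id m) (perm_of_mask m) = m.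
Proof.
apply: val_inj; apply: (@eq_from_nth _ false); rewrite !size_tuple // => i hi.
pose o := Ordinal hi; rewrite (nth_mask_of_perm _ _ o).
set a := ((perm_of_mask m)^-1)%g o; rewrite -[ i ]/(nat_of_ord o).
have -> : o = perm_of_mask m a by rewrite permKV.
rewrite -mem_mask_iota -(nth_word_of (perm_of_mask m)) word_of_mask nth_cat -count_mask.
case: ltnP => ha; first by rewrite mem_nth // -count_mask.
symmetry; apply/negP => h.
have := perm_uniq (mask_wordP m); rewrite iota_uniq cat_uniq => /and3P[_ /hasP[]].
exists (nth 0%N (mask (map negb m) (iota 0 n)) (a - count id m)) => //.
apply: mem_nth; have := perm_size (mask_wordP m).
by rewrite size_cat -count_mask size_iota; have := ltn_ord a; lia.
Qed.

Lemma take_word_shuffle (p : nat) (sigma : 'S_n) : shuffle p sigma ->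
  sorted ltn (take p (word_of sigma)) /\ sorted ltn (drop p (word_of sigma)).
Proof.
move=> /forallP h.
have key (a b : nat) : (a < b < n)%N -> ((b < p) || (p <= a))%N ->
    (nth 0 (word_of sigma) a < nth 0 (word_of sigma) b)%N.
  move=> /andP[ab bn] hab; have an := ltn_trans ab bn.
  rewrite (nth_word_of sigma (Ordinal an)) (nth_word_of sigma (Ordinal bn)).
  by have /forallP/(_ (Ordinal bn))/implyP := h (Ordinal an); rewrite /= ab hab; apply.
split; apply/(sortedP 0%N) => i.
  rewrite size_take_min size_word_of leq_min => /andP[ip isz].
  by rewrite !nth_take ?(ltnW ip) //; apply: key; rewrite ?ltnSn ?isz ?ip.
rewrite size_drop size_word_of => hi; rewrite !nth_drop.
by apply: key; rewrite ?addnS ?ltnSn ?leq_addr ?orbT //=; lia.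
Qed.

Lemma mask_of_permP (p : nat) (sigma : 'S_n) : shuffle p sigma ->
  mask (mask_of_perm p sigma) (iota 0 n) = take p (word_of sigma) /\
  mask (map negb (mask_of_perm p sigma)) (iota 0 n) = drop p (word_of sigma).
Proof.
move=> /take_word_shuffle[st sd].
have E1 : mask (mask_of_perm p sigma) (iota 0 n) = take p (word_of sigma).
  apply: (irr_sorted_eq ltn_trans ltnn) => //; first exact: sorted_mask_iota.
  move=> i; have [hi|hi] := ltnP i n; last first.
    apply/idP/idP => [/mem_mask|/mem_take]; last rewrite (perm_mem (perm_word_of _)).
      by rewrite mem_iota add0n /= ltnNge hi.
    by rewrite mem_iota add0n /= ltnNge hi.
  rewrite -[ i ]/(nat_of_ord (Ordinal hi)) mem_mask_iota nth_mask_of_perm.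
  set a := (sigma^-1)%g _; have -> : Ordinal hi = sigma a by rewrite permKV.
  have uw : uniq (word_of sigma) by rewrite (perm_uniq (perm_word_of _)) iota_uniq.
  rewrite -nth_word_of in_take ?mem_nth ?size_word_of //.
  by rewrite index_uniq ?size_word_of.
split=> //; apply: (irr_sorted_eq ltn_trans ltnn) => //.
  exact: sorted_mask_iota.
apply: perm_mem; rewrite -(perm_cat2l (take p (word_of sigma))) cat_take_drop.
rewrite -E1 (perm_trans (mask_wordP _)) // perm_sym; exact: perm_word_of.
Qed.

Lemma mask_of_permK (p : nat) (sigma : 'S_n) : (p <= n)%N -> shuffle p sigma ->
  count id (mask_of_perm p sigma) = p /\ perm_of_mask (mask_of_perm p sigma) = sigma.
Proof.
move=> pn /mask_of_permP[E1 E2]; split.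
  by rewrite count_mask E1 size_takel // size_word_of.
by apply: word_of_inj; rewrite word_of_mask /mask_word E1 E2 cat_take_drop.
Qed.

End Unshuffle.

Lemma mask_sign_word (s : seq T) (m : bitseq) (k : nat) :
  mask_sign m (map (nth hom0 s) (iota k (size m))) =
  \prod_(a <- mask m (iota k (size m)))
    \prod_(b <- mask (map negb m) (iota k (size m)) | (a < b)%N)
       sg K (tag (nth hom0 s a) * tag (nth hom0 s b)).
Proof.
elim: m k => [|[] m IH] k /=; rewrite ?big_nil // IH.
  rewrite big_cons; congr (_ * _).
  rewrite -map_mask big_seq_cond (eq_bigl (mem (mask (map negb m) (iota k.+1 (size m))))).
    rewrite -big_seq; elim: (mask _ _) => [|b w IHw]; first by rewrite big_nil deg_nil mulr0.
    by rewrite big_cons /= deg_cons mulrDr sgD IHw.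
  move=> b /=; case hb : (b \in _) => //=.
  by have := mem_mask hb; rewrite mem_iota => /andP[].
rewrite [RHS]big_seq [LHS]big_seq; apply: eq_bigr => a /mem_mask.
by rewrite mem_iota big_cons => /andP[ka _]; rewrite ltnNge (ltnW ka).
Qed.

Lemma kos_mask (s : seq T) (u v : seq nat) : sorted ltn u -> sorted ltn v ->
  uniq (u ++ v) ->
  kos s (u ++ v) * sg K (deg (map (nth hom0 s) u) * deg (map (nth hom0 s) v)) =
  \prod_(a <- u) \prod_(b <- v | (a < b)%N)
     sg K (tag (nth hom0 s a) * tag (nth hom0 s b)).
Proof.
move=> hu hv huv; rewrite kos_cat !kos_sorted // !mul1r.
have -> : sg K (deg (map (nth hom0 s) u) * deg (map (nth hom0 s) v)) =
  \prod_(a <- u) \prod_(b <- v) sg K (tag (nth hom0 s a) * tag (nth hom0 s b)).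
  elim: {hu huv} u => [|a u IH]; first by rewrite big_nil deg_nil mul0r.
  rewrite big_cons -IH /= deg_cons mulrDl sgD; congr (_ * _).
  elim: {hv IH} v => [|b v IH]; first by rewrite big_nil deg_nil mulr0.
  by rewrite big_cons -IH /= deg_cons mulrDr sgD.
rewrite -big_split big_seq [RHS]big_seq; apply: eq_bigr => a au /=.
rewrite [X in _ * X](bigID (fun b => (b < a)%N)) /= mulrA -big_split /= big1 ?mul1r; last first.
  by move=> b _; rewrite sgsq.
rewrite big_seq_cond [RHS]big_seq_cond; apply: eq_bigl => b.
case bv : (b \in v) => //=; rewrite -leqNgt leq_eqVlt.
have [eab|//] := eqVneq a b.
move: huv; rewrite cat_uniq => /and3P[_ /hasPn/(_ b bv)]; by rewrite /= -eab au.
Qed.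

(** Shuffles are reindexed by masks, p being the number of entries [true]. The masks with p = 0 or p
    = n, which [fun_mul] leaves out, contribute nothing since the factors have no constant term. *)
Lemma fun_mulE (f g : W) : f [::] = 0 -> g [::] = 0 -> fun_mul f g = f * g.
Proof.
move=> f0 g0; apply/funext => s; rewrite mulE_masks.
pose F (p : nat) (sigma : 'S_(size s)) := koszul sigma *
    (-1) ^ (deg (take p (permute sigma)) * deg (drop p (permute sigma))) *
    (f (take p (permute sigma)) * g (drop p (permute sigma))).
pose n := size s.
have -> : fun_mul f g s =
    \sum_(p < n.+1) \sum_(sigma : 'S_(size s) | shuffle p sigma) F p sigma.
  have szp (sigma : 'S_(size s)) : size (permute sigma) = n.
    by rewrite permuteE size_map size_word_of.
  rewrite /fun_mul; have [n0|n0] := posnP n.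
    rewrite big_geq -/n ?n0 // big1 // => p _; rewrite big1 // => sigma _.
    have p0 : permute sigma = [::] by apply: size0nil; rewrite szp.
    by rewrite /F p0 f0 mul0r mulr0.
  rewrite -(big_mkord xpredT (fun p => \sum_(sigma | shuffle p sigma) F p sigma)).
  rewrite [RHS]big_ltn // [X in _ = X + _]big1 ?add0r; last first.
    by move=> sigma _; rewrite /F take0 f0 mul0r mulr0.
  rewrite [RHS]big_nat_recr //= [X in _ = _ + X]big1 ?addr0 // => sigma _.
  by rewrite /F drop_oversize ?g0 ?mulr0 // szp.
rewrite pair_big_dep /=.
pose h (m : n.-tuple bool) : 'I_n.+1 * 'S_n :=
  (Ordinal (count_mask_le m), perm_of_mask m).
rewrite (reindex_onto h (fun x => mask_of_perm x.1 x.2)); last first.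
  move=> [p sigma] /= /(mask_of_permK (leq_ord p)) [e1 e2].
  by rewrite /h e2; congr (_, _); apply: val_inj.
rewrite (eq_bigl xpredT); last first.
  by move=> m; rewrite /= shuffle_of_mask perm_of_maskK eqxx.
have pm : perm_eq (map val (enum {: n.-tuple bool})) (masks n).
  apply: uniq_perm; first by rewrite map_inj_uniq ?enum_uniq //; apply: val_inj.
    exact: uniq_masks.
  move=> m; rewrite mem_masks; apply/mapP/idP => [[t _ ->]|hm].
    by rewrite size_tuple.
  by exists (Tuple hm); rewrite ?mem_enum.
rewrite -(perm_big _ pm) big_map big_enum /=; apply: eq_bigr => m _.
rewrite /F permuteE word_of_mask koszulE word_of_mask map_cat.
have szm : size (map (nth hom0 s) (mask m (iota 0 (size s)))) = count id m.
  by rewrite size_map count_mask.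
rewrite -szm take_size_cat // drop_size_cat // kos_mask; first last.
- by rewrite (perm_uniq (mask_wordP m)) iota_uniq.
- exact: sorted_mask_iota.
- exact: sorted_mask_iota.
have eiota : map (nth hom0 s) (iota 0 (size s)) = s by exact: mkseq_nth.
rewrite !map_mask eiota; congr (_ * _).
have := mask_sign_word s m 0; rewrite size_tuple eiota => ->.
by [].
Qed.

End Shuffles.

(** * Homogeneous bases and the Euler formula *)

Section Basis.
Variables (K : numFieldType) (E : gradedVect K).
Local Notation W := (shuf E).
Local Notation T := (homog E).

(* A homogeneous basis [gvec] and its dual basis [gco]. *)
Record gbasis := GBasis {
  gdim : nat;
  gdeg : 'I_gdim -> int;
  gvec : forall i : 'I_gdim, E (gdeg i);
  gco : 'I_gdim -> W;
  gco_symf : forall i, symf (gco i);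
  gco_linear : forall i s, size s != 1%N -> gco i s = 0;
  gco_hdeg : forall i, hdeg (- gdeg i) (gco i);
  gco_dual : forall i j, gco i [:: hom_of (gvec j)] = (i == j)%:R;
  gco_expand : forall (f : W) s x, symf f ->
    f (rcons s x) = \sum_i gco i [:: x] * f (rcons s (hom_of (gvec i)));
  gco_supertrace : forall h : (forall i : int, E i -> E i),
    \sum_(i \in [set: int]%classic) sg K i * trace (h i) =
      \sum_i sg K (gdeg i) * gco i [:: hom_of (h (gdeg i) (gvec i))]
}.

Lemma untag_hom (i : int) (F : E i -> K) (v : E i) : untag 0 F (hom_of v) = F v.
Proof. exact: (untagE _ _ (u := hom_of v) erefl). Qed.

(** The basis is the union of the bases of the finitely many nonzero pieces, indexed by pairs of a
    degree and a position in [vbasis]. *)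
Lemma gbasis_exists : inhabited gbasis.
Proof.
have [X hX] := (finite_fsetP.1 (gpiece_fin E)).
pose I := {i : X & 'I_(\dim {:E (val i)})}.
pose idx (k : 'I_#|{: I}|) : I := enum_val k.
pose vec k : E (val (tag (idx k))) := (vbasis {:E (val (tag (idx k)))})`_(tagged (idx k)).
(* The default value 0 of [untag] makes the dual form vanish on letters of another degree. *)
pose co k : W := fun s => if s is [:: x] then
  untag 0 (coord (vbasis {:E (val (tag (idx k)))}) (tagged (idx k))) x else 0.
have sumI (V : nmodType) (F : I -> V) :
    \sum_k F (idx k) = \sum_(i : X) \sum_(a < \dim {:E (val i)}) F (Tagged _ a).
  rewrite sig_big_dep /= (reindex idx) /=.
    by apply: eq_bigr => k _; rewrite /idx; case: (enum_val k).
  exact: onW_bij (enum_val_bij I).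
have notX i : i \notin X -> \dim {:E i} = 0%N.
  move=> iX; apply/eqP; apply: contraNT iX => di.
  by have : [set i | \dim {:E i} != 0%N]%classic i by []; rewrite hX.
have freeB i : free (vbasis {:E i}) by apply: basis_free (vbasisP _).
apply: inhabits; apply: (@GBasis _ (fun k => val (tag (idx k))) vec co).
- move=> k; split=> [[|x [|y s1]] [|z s2] i a u v|[|x [|y s1]] [|z s2] u v] //=;
    rewrite ?(mulr0, addr0) //.
  have [e|ne] := eqVneq i (val (tag (idx k))).
    by case: _ / (esym e) u v => u v; rewrite !untag_hom linearP.
  by rewrite !untag_dflt ?mulr0 ?addr0.
- by move=> k [|x [|y s]].
- move=> k [|x [|y s]] //=; rewrite deg_cons deg_nil addr0 opprK => ne.
  by rewrite untag_dflt.
- move=> k l /=; have [<-|ne] := eqVneq k l.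
    by rewrite untag_hom coord_free // eqxx.
  have : idx k != idx l by rewrite (inj_eq enum_val_inj).
  rewrite /vec; case: (idx k) (idx l) => [i a] [j b] /= ne'.
  have [e|nij] := eqVneq (val j) (val i); last by rewrite untag_dflt.
  move/val_inj in e; case: _ / (esym e) b ne' => b ne'.
  rewrite untag_hom coord_free //; case: eqVneq => // ab.
  by rewrite ab eqxx in ne'.
- move=> f s x hf.
  pose G (t : I) := untag 0 (coord (vbasis {:E (val (tag t))}) (tagged t)) x *
    f (rcons s (hom_of (vbasis {:E (val (tag t))})`_(tagged t))).
  rewrite -[RHS]/(\sum_k G (idx k)) sumI /G /=.
  case: x {G} => i v; rewrite -[existT _ i v]/(hom_of v).
  have f0 (j : int) : f (rcons s (hom_of (0 : E j))) = 0.
    by rewrite -cats1 symf_zero.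
  have fs n (c : 'I_n -> K) (w : 'I_n -> E i) :
      f (rcons s (hom_of (\sum_a c a *: w a))) = \sum_a c a * f (rcons s (hom_of (w a))).
    elim: n c w => [|n IH] c w; first by rewrite !big_ord0 f0.
    rewrite !big_ord_recl -IH -!cats1; exact: (symf_linear hf).
  have [iX|iX] := boolP (i \in X); last first.
    have /eqP := notX i iX; rewrite dimv_eq0 => /eqP i0.
    have -> : v = 0 by apply/eqP; rewrite -memv0 -i0 memvf.
    rewrite f0 big1 // => j _; rewrite big1 // => a _.
    rewrite untag_dflt ?mul0r //; apply: contraNneq iX => /= ->; exact: valP.
  rewrite (bigD1 [` iX]%fset) //= [X in _ + X]big1 ?addr0; last first.
    move=> j ne; rewrite big1 // => a _; rewrite untag_dflt ?mul0r //.
    by apply: contraNneq ne => /= e; apply/eqP/val_inj.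
  rewrite {1}(coord_vbasis (memvf v)) fs; apply: eq_bigr => a _.
  by rewrite untag_hom.
- move=> h.
  pose G (t : I) := sg K (val (tag t)) * untag 0
    (coord (vbasis {:E (val (tag t))}) (tagged t))
    (hom_of (h _ (vbasis {:E (val (tag t))})`_(tagged t))).
  rewrite -[RHS]/(\sum_k G (idx k)) sumI /G /=.
  rewrite (fsbigTE X) => [|i /notX di]; last first.
    rewrite /trace big1 ?mulr0 // => a _; suff : (a < 0)%N by [].
    by rewrite -[X in (_ < X)%N]di.
  rewrite big_seq_fsetE /=; apply: eq_bigr => i _; rewrite /trace mulr_sumr.
  by apply: eq_bigr => a _; rewrite untag_hom.
Qed.

End Basis.

Arguments gdeg {K E} g i.
Arguments gvec {K E} g i.
Arguments gco {K E} g i.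
Arguments gco_symf {K E} g i.
Arguments gco_hdeg {K E} g i.

Section Euler.
Variables (K : numFieldType) (E : gradedVect K) (B : gbasis E).
Local Notation W := (shuf E).
Local Notation xi := (gco B).
Local Notation evec i := (hom_of (gvec B i)).

Lemma gco_nil i : xi i [::] = 0.
Proof. exact: gco_linear. Qed.

Lemma dl_gco x i : dl x (xi i) = xi i [:: x] *: 1.
Proof.
apply/funext=> -[|y s]; rewrite shufZE shuf1E /dl ?mulr1 //.
by rewrite mulr0 gco_linear.
Qed.

Lemma dr_gco j i : dr (evec j) (xi i) = (i == j)%:R *: 1.
Proof.
apply/funext=> -[|y s]; rewrite shufZE shuf1E /dr /= ?mulr1 ?gco_dual //.
by rewrite mulr0 gco_linear //= size_rcons.
Qed.

(** By induction on the word: a first letter read by xi_i gives back f, by [gco_expand] and after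
    moving that letter to the end; a first letter read by the derivative leads to the case of
    [dl x f]. *)
Lemma euler (f : W) s : symf f ->
  (\sum_i xi i * dr (evec i) f) s = (size s)%:R * f s.
Proof.
elim: s f => [|x s IH] f hf; rewrite shuf_sumE.
  by rewrite mul0r big1 // => i _; rewrite shuf_mul_nil gco_nil mul0r.
under eq_bigr do rewrite shuf_mul_cons dl_gco -scalerAl mul1r shufZE.
rewrite big_split /= -(shuf_sumE _ _ (fun i => xi i * dl x (dr (evec i) f))).
rewrite -[X in _ + X]/((\sum_i xi i * dr (evec i) (dl x f)) s) IH; last exact: symf_dl.
rewrite -[X in X + _]/(\sum_i xi i [:: x] * (sg K (tag x * deg s) *
  f (rcons s (evec i)))).
under eq_bigr do rewrite mulrCA.
by rewrite -mulr_sumr -gco_expand // -symf_rcons // -add1n natrD mulrDl mul1r.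
Qed.

(** Euler's formula divided by the arity. The factors g_i lose one step of the filtration, which is
    what inductions on the arity consume. *)
Lemma symf_decomp (f : W) : symf f -> exists g : 'I_(gdim B) -> W,
  [/\ forall i, symf (g i), forall m, vanish m.+1 f -> forall i, vanish m (g i) &
      f = f [::] *: 1 + \sum_i xi i * g i].
Proof.
(* In arity 0 the weight is 0^-1 = 0, but [dr] never reads the empty word and the constant term is
   kept apart. *)
move=> hf; pose f' : W := fun s => (size s)%:R^-1 * f s.
have hf' : symf f' by apply: (symf_weight (fun k => k%:R^-1)).
exists (fun i => dr (evec i) f'); split.
- by move=> i; apply: symf_dr.
- move=> m hm i s hs; rewrite /dr /f' hm ?mulr0 //.
  by rewrite size_rcons.
- apply/funext=> s; rewrite shufDE euler // shufZE shuf1E /f'.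
  case: s => [|x s] /=; first by rewrite mulr1 mul0r addr0.
  by rewrite mulr0 add0r mulrA divff ?mul1r // pnatr_eq0.
Qed.

End Euler.

(** The given differentials and morphisms are controlled on symmetric functions only, so linearity
    is asked there alone. *)
Definition linear_on_symf (K : numFieldType) (E F : gradedVect K)
    (C : shuf E -> shuf F) : Prop :=
  forall (a : K) f g, symf f -> symf g -> C (a *: f + g) = a *: C f + C g.

Section LinearOnSymf.
Variables (K : numFieldType) (E F : gradedVect K) (C : shuf E -> shuf F).
Hypothesis C_lin : linear_on_symf C.

Lemma lsymf0 : C 0 = 0.
Proof.
have := C_lin 1 (@symf0 K E) (@symf0 K E).
rewrite !scale1r addr0 => /eqP; by rewrite -subr_eq subrr eq_sym => /eqP.
Qed.

Lemma lsymfD f g : symf f -> symf g -> C (f + g) = C f + C g.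
Proof. by move=> hf hg; have := C_lin 1 hf hg; rewrite !scale1r. Qed.

Lemma lsymfZ a f : symf f -> C (a *: f) = a *: C f.
Proof. by move=> hf; have := C_lin a hf (@symf0 K E); rewrite lsymf0 !addr0. Qed.

Lemma lsymfN f : symf f -> C (- f) = - C f.
Proof. by move=> hf; rewrite -scaleN1r lsymfZ // scaleN1r. Qed.

Lemma lsymfB f g : symf f -> symf g -> C (f - g) = C f - C g.
Proof. by move=> hf hg; rewrite lsymfD ?lsymfN //; apply: symfN. Qed.

Lemma lsymf_sum (I : Type) (r : seq I) (P : pred I) (G : I -> shuf E) :
  (forall i, P i -> symf (G i)) ->
  C (\sum_(i <- r | P i) G i) = \sum_(i <- r | P i) C (G i).
Proof.
move=> hG; pose R u v := symf u /\ C u = v.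
suff [] : R (\sum_(i <- r | P i) G i) (\sum_(i <- r | P i) C (G i)) by [].
apply: big_rec2; first by split; [apply: symf0|apply: lsymf0].
move=> i v u Pi [hu <-]; have hi := hG i Pi.
by split; [apply: symfD|rewrite lsymfD].
Qed.

(* A map vanishing on constants and multiplicative up to the ideal of positive
   arity is determined by the generators [gco B i]. *)
Lemma symf_ind_null (B : gbasis E) : C 1 = 0 ->
  (forall i g, symf g -> exists2 u : shuf F, u [::] = 0 & C (gco B i * g) = u * C g) ->
  forall f, symf f -> C f = 0.
Proof.
move=> C1 CM f hf; suff H m : forall g, symf g -> vanish m (C g).
  by apply/funext=> s; apply: (H (size s).+1).
(* If all values of [C] vanish below arity m, then a product u * C g with u of positive arity
   vanishes below m + 1. *)
elim: m => [|m IH] g hg; first exact: vanish0.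
have [h [hh _ ->]] := symf_decomp B hg.
have sh i : symf (gco B i * h i) by apply: symfM => //; apply: gco_symf.
rewrite C_lin ?C1 ?scaler0 ?add0r; first last.
- by apply: symf_sum.
- exact: symf1.
rewrite lsymf_sum //; apply: vanish_sum => i _.
have [u u0 ->] := CM i _ (hh i).
by rewrite -add1n; apply: vanishM; [apply: vanish1|apply: IH].
Qed.

End LinearOnSymf.

(** * Differentials and morphisms on functions with constant term *)

Section DG.
Variable K : numFieldType.

(** [dgd_nil] reflects that there is no bracket l_0; thanks to it, D respects the filtration by
    arity. *)
Record dg_derivation (E : gradedVect K) (D : shuf E -> shuf E) : Prop := DGDerivation {
  dgd_symf : forall f, symf f -> symf (D f);
  dgd_nil : forall f, symf f -> D f [::] = 0;
  dgd_lin : linear_on_symf D;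
  dgd_hdeg : forall n f, symf f -> hdeg n f -> hdeg (n + 1) (D f);
  dgd_mul : forall n f g, symf f -> hdeg n f -> symf g ->
    D (f * g) = D f * g + sg K n *: (f * D g);
  dgd_sq : forall f, symf f -> D (D f) = 0
}.

Lemma dgd1 (E : gradedVect K) (D : shuf E -> shuf E) : dg_derivation D -> D 1 = 0.
Proof.
move=> hD; have := dgd_mul hD (@symf1 K E) (@hdeg1 K E) (@symf1 K E).
rewrite !mulr1 mul1r sg0 scale1r => /eqP; by rewrite -subr_eq subrr eq_sym => /eqP.
Qed.

(** By linearity, D f in low arities depends on f in the same arities only, so D can be computed on
    truncated series. *)
Lemma dgd_vanish (E : gradedVect K) (D : shuf E -> shuf E) (B : gbasis E) m f :
  dg_derivation D -> symf f -> vanish m f -> vanish m (D f).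
Proof.
move=> hD; elim: m f => [|m IH] f hf hm; first exact: vanish0.
have [g [hg hgm ->]] := symf_decomp B hf.
rewrite hm // scale0r add0r (lsymf_sum (dgd_lin hD)); last first.
  by move=> i _; apply: symfM => //; apply: gco_symf.
apply: vanish_sum => i _; rewrite (dgd_mul hD (gco_symf B i) (@gco_hdeg _ _ B i) (hg i)).
rewrite -add1n; apply: vanishD.
  by apply: vanishM; [apply/vanish1/(dgd_nil hD)/gco_symf|apply: hgm].
apply/vanishZ/vanishM; first exact/vanish1/gco_nil.
by apply: IH => //; apply: hgm.
Qed.

Record dg_morphism (E F : gradedVect K) (DE : shuf E -> shuf E) (DF : shuf F -> shuf F)
    (P : shuf F -> shuf E) : Prop := DGMorphism {
  dgm_symf : forall f, symf f -> symf (P f);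
  dgm_nil : forall f, symf f -> P f [::] = f [::];
  dgm_lin : linear_on_symf P;
  dgm1 : P 1 = 1;
  dgm_hdeg : forall n f, symf f -> hdeg n f -> hdeg n (P f);
  dgm_mul : forall f g, symf f -> symf g -> P (f * g) = P f * P g;
  dgm_diff : forall f, symf f -> P (DF f) = DE (P f)
}.

(* [is_differential] and [is_morphism] only concern functions without constant term;
   [aug] projects onto these, and [unital_ext] fixes the constants. *)
Definition aug (E : gradedVect K) (f : shuf E) : shuf E := f - f [::] *: 1.

Section Aug.
Variable E : gradedVect K.
Implicit Types f g : shuf E.

Lemma aug_nil f : aug f [::] = 0.
Proof. by rewrite /aug shufDE shufNE shufZE shuf1E mulr1 subrr. Qed.

Lemma aug_symf f : symf f -> symf (aug f).
Proof. by move=> hf; apply: symfB => //; apply/symfZ/symf1. Qed.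

Lemma aug_fun f : symf f -> is_function (aug f).
Proof. by move=> hf; apply/is_functionP; split; [apply: aug_symf|apply: aug_nil]. Qed.

Lemma aug_id f : f [::] = 0 -> aug f = f.
Proof. by move=> f0; rewrite /aug f0 scale0r subr0. Qed.

Lemma hdeg_aug n f : hdeg n f -> hdeg n (aug f).
Proof.
move=> hf [|x s] hs; first exact: aug_nil.
by rewrite /aug shufDE shufNE shufZE shuf1E mulr0 subr0 hf.
Qed.

(** A homogeneous function with nonzero constant term has degree 0, hence sign 1. *)
Lemma hdeg_nil n f : hdeg n f -> sg K n * f [::] = f [::].
Proof.
move=> hf; have [->|n0] := eqVneq n 0; first by rewrite sg0 mul1r.
by rewrite hf ?mulr0 // deg_nil; apply: contraNneq n0 => e; lia.
Qed.

Lemma aug_lin a f g : aug (a *: f + g) = a *: aug f + aug g.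
Proof.
apply/funext=> s; rewrite /aug !(shufDE, shufNE, shufZE); ring.
Qed.

Lemma aug_mul f g :
  aug (f * g) = aug f * aug g + (f [::] *: aug g + g [::] *: aug f).
Proof.
rewrite /aug shuf_mul_nil mulrBl !mulrBr -!scalerAl -!scalerAr !mul1r !mulr1.
apply/funext=> s; rewrite !(shufDE, shufNE, shufZE); ring.
Qed.

End Aug.

Lemma is_differential_dg (E : lieInfty K) (Q : cochain E -> cochain E) :
  is_differential Q -> dg_derivation (Q \o @aug E).
Proof.
move=> hQ; set D : shuf E -> shuf E := Q \o @aug E.
have Dfun f : symf f -> is_function (D f).
  by move=> hf; apply: differential_fun hQ _ (aug_fun hf).
have D0 f : symf f -> D f [::] = 0 by move=> /Dfun/is_functionP[].
have Dlin : linear_on_symf D.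
  move=> a f g hf hg; rewrite /D /= aug_lin.
  exact: (differential_linear hQ a (aug_fun hf) (aug_fun hg)).
have Dhdeg n f : symf f -> hdeg n f -> hdeg (n + 1) (D f).
  move=> hf fn; have [] // := @differential_degree _ _ _ hQ n (aug f).
  by split; [apply: aug_fun|apply: hdeg_aug].
split=> //.
- by move=> f /Dfun/is_functionP[].
- move=> n f g hf fn hg.
  have Daug h : D (aug h) = D h by rewrite /D /= (aug_id (aug_nil _)).
  have hu : symf (aug f) by apply: aug_symf.
  have hv : symf (aug g) by apply: aug_symf.
  have E1 : D (aug f * aug g) = D f * aug g + sg K n *: (aug f * D g).
    rewrite /D /= aug_id ?shuf_mul_nil ?aug_nil ?mul0r //.
    rewrite -(fun_mulE (aug_nil f) (aug_nil g)).
    rewrite -(fun_mulE (D0 _ hf) (aug_nil g)) -(fun_mulE (aug_nil f) (D0 _ hg)).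
    apply: (differential_leibniz hQ) (aug_fun hg).
    by split; [apply: aug_fun|apply: hdeg_aug].
  rewrite -Daug aug_mul (lsymfD Dlin); first last.
  + by apply: symfD; apply: symfZ.
  + exact: symfM.
  rewrite E1 (lsymfD Dlin) ?(lsymfZ Dlin) //; try exact: symfZ.
  rewrite !Daug.
  have -> : D f * g = g [::] *: D f + D f * aug g.
    by rewrite /aug mulrBr -scalerAr mulr1 addrC subrK.
  have -> : sg K n *: (f * D g) = f [::] *: D g + sg K n *: (aug f * D g).
    rewrite /aug mulrBl -scalerAl mul1r scalerBr scalerA (hdeg_nil fn).
    by rewrite addrC subrK.
  apply/funext=> s; rewrite !(shufDE, shufNE, shufZE); ring.
- move=> f hf; rewrite {1}/D /= (aug_id (D0 _ hf)); apply/funext=> s.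
  exact: (differential_square hQ (aug_fun hf)).
Qed.

Definition unital_ext (E F : gradedVect K) (P : shuf F -> shuf E) (f : shuf F) : shuf E :=
  f [::] *: 1 + P (aug f).

Lemma is_morphism_dg (E F : lieInfty K) QE QF (P : cochain F -> cochain E) :
  is_differential QF -> is_morphism QE QF P ->
  dg_morphism (QE \o @aug E) (QF \o @aug F) (unital_ext P).
Proof.
move=> hQF hP; pose D (f : shuf F) : shuf E := P (aug f).
have Dfun f : symf f -> is_function (D f).
  by move=> hf; apply: morphism_fun hP _ (aug_fun hf).
have D0 f : symf f -> D f [::] = 0 by move=> /Dfun/is_functionP[].
have Ds f : symf f -> symf (D f) by move=> /Dfun/is_functionP[].
have Dlin : linear_on_symf D.
  move=> a f g hf hg; rewrite /D aug_lin.
  exact: (morphism_linear hP a (aug_fun hf) (aug_fun hg)).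
rewrite /unital_ext; split.
- by move=> f hf; apply: symfD; [apply/symfZ/symf1|apply: Ds].
- by move=> f hf; rewrite shufDE shufZE shuf1E mulr1 -/(D f) D0 ?addr0.
- move=> a f g hf hg; rewrite -!/(D _) Dlin // shufDE shufZE.
  by apply/funext=> s; rewrite !(shufDE, shufNE, shufZE); ring.
- have -> : aug (1 : shuf F) = 0 by rewrite /aug shuf1E scale1r subrr.
  have D00 := lsymf0 Dlin; rewrite /D (aug_id (shuf0E _)) in D00.
  by rewrite D00 shuf1E scale1r addr0.
- move=> n f hf fn; apply: hdegD.
    move=> [|x s]; rewrite shufZE shuf1E; last by rewrite mulr0.
    by rewrite deg_nil => hs; rewrite fn ?mul0r ?deg_nil.
  have [] // := morphism_degree hP (n := n) (f := aug f).
  by split; [apply: aug_fun|apply: hdeg_aug].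
- move=> f g hf hg; rewrite -!/(D _).
  have Daug h : D (aug h) = D h by rewrite /D (aug_id (aug_nil _)).
  have hu : symf (aug f) by apply: aug_symf.
  have hv : symf (aug g) by apply: aug_symf.
  have E1 : D (aug f * aug g) = D f * D g.
    rewrite /D aug_id ?shuf_mul_nil ?aug_nil ?mul0r //.
    rewrite -(fun_mulE (aug_nil f) (aug_nil g)).
    rewrite -(fun_mulE (D0 _ hf) (D0 _ hg)).
    exact: (morphism_mul hP (aug_fun hf) (aug_fun hg)).
  rewrite -Daug aug_mul (lsymfD Dlin); first last.
  + by apply: symfD; apply: symfZ.
  + exact: symfM.
  rewrite E1 (lsymfD Dlin) ?(lsymfZ Dlin) //; try exact: symfZ.
  rewrite !Daug shuf_mul_nil mulrDl !mulrDr -!scalerAl -!scalerAr !(mulr1, mul1r).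
  apply/funext=> s; rewrite !(shufDE, shufNE, shufZE); ring.
- move=> f hf; have hQ := is_differential_dg hQF.
  rewrite (dgd_nil hQ hf) scale0r add0r (aug_id (dgd_nil hQ hf)) /=.
  rewrite (morphism_differential hP (aug_fun hf)); congr QE.
  rewrite -/(D f) /aug shufDE shufZE shuf1E mulr1.
  by rewrite D0 // addr0 addrC addKr.
Qed.

End DG.

(** * Traces of flat connections *)

Section SuperMatrices.
Variables (K : numFieldType) (E : gradedVect K) (n : nat) (delta : 'I_n -> int).
Local Notation W := (shuf E).
Implicit Types X Y : 'M[W]_n.

(* Matrices of endomorphisms of degree [k] of the free right module on generators
   of degrees [delta]; right linearity makes composition the plain matrix product. *)
Definition mxdeg (k : int) X : Prop :=
  forall i j, symf (X i j) /\ hdeg (k + delta i - delta j) (X i j).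

Definition mxvanish (m : nat) X : Prop := forall i j, vanish m (X i j).

Definition cst_mx (M : 'M[K]_n) : 'M[W]_n := \matrix_(i, j) (M i j)%:A.

Definition arity0 X : 'M[K]_n := \matrix_(i, j) X i j [::].

Lemma mxdegD k X Y : mxdeg k X -> mxdeg k Y -> mxdeg k (X + Y).
Proof.
move=> hX hY i j; have [sX dX] := hX i j; have [sY dY] := hY i j.
by rewrite mxE; split; [apply: symfD|apply: hdegD].
Qed.

Lemma mxdegN k X : mxdeg k X -> mxdeg k (- X).
Proof.
move=> hX i j; have [sX dX] := hX i j.
by rewrite mxE; split; [apply: symfN|apply: hdegN].
Qed.

Lemma mxdegM k l X Y : mxdeg k X -> mxdeg l Y -> mxdeg (k + l) (X * Y).
Proof.
move=> hX hY i j; rewrite !mxE; split.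
  by apply: symf_sum => a _; apply: symfM; [case: (hX i a)|case: (hY a j)].
apply: hdeg_sum => a _; have [_ dX] := hX i a; have [_ dY] := hY a j.
by have := hdegM dX dY; rewrite (_ : _ + _ = k + l + delta i - delta j) //; lia.
Qed.

Lemma mxdeg1 : mxdeg 0 1.
Proof.
move=> i j; rewrite mxE add0r; case: eqP => [->|_].
  by rewrite subrr; split; [apply: symf1|apply: hdeg1].
by split; [apply: symf0|apply: hdeg0].
Qed.

Lemma mxdegX X k : mxdeg 0 X -> mxdeg 0 (X ^+ k).
Proof.
move=> hX; elim: k => [|k IH]; first exact: mxdeg1.
by rewrite exprS; apply: (mxdegM hX IH).
Qed.

Lemma mxvanishM m p X Y : mxvanish m X -> mxvanish p Y -> mxvanish (m + p) (X * Y).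
Proof. by move=> hX hY i j; rewrite mxE; apply: vanish_sum => a _; apply: vanishM. Qed.

Lemma mxvanishX X k : mxvanish 1 X -> mxvanish k (X ^+ k).
Proof.
move=> hX; elim: k => [|k IH] //; rewrite exprS -add1n; exact: mxvanishM.
Qed.

Lemma vanish_mxtrace m X : mxvanish m X -> vanish m (\tr X).
Proof. by move=> hX; apply: vanish_sum. Qed.

(** Exchanging [X i j] and [Y j i] costs the sign of d (1 - d) with d = delta i - delta j, a product
    of consecutive integers up to sign, hence even. *)
Lemma mxtrace_commute X Y : mxdeg 0 X -> mxdeg 1 Y -> \tr (X * Y) = \tr (Y * X).
Proof.
move=> hX hY; rewrite /mxtrace.
under eq_bigr do rewrite mxE; under [RHS]eq_bigr do rewrite mxE.
rewrite exchange_big; apply: eq_bigr => j _; apply: eq_bigr => i _ /=.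
have [_ dX] := hX i j; have [_ dY] := hY j i.
rewrite (mulC_hdeg dX dY) sgE (_ : odd _ = false) ?scale1r // abszM oddM; lia.
Qed.

Lemma cst_mxM (M N : 'M[K]_n) : cst_mx M * cst_mx N = cst_mx (M * N).
Proof.
apply/matrixP => i j; rewrite !mxE scaler_suml; apply: eq_bigr => k _.
by rewrite !mxE -scalerAl mul1r scalerA.
Qed.

Lemma cst_mxD (M N : 'M[K]_n) : cst_mx M + cst_mx N = cst_mx (M + N).
Proof. by apply/matrixP => i j; rewrite !mxE scalerDl. Qed.

Lemma cst_mx1 : cst_mx 1 = 1.
Proof.
apply/matrixP => i j; rewrite !mxE; case: (i == j) => /=; last by rewrite scale0r.
by rewrite scale1r.
Qed.

Lemma mxdeg_cst k (M : 'M[K]_n) :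
  (forall i j, k + delta i - delta j != 0 -> M i j = 0) -> mxdeg k (cst_mx M).
Proof.
move=> hM i j; rewrite mxE; split; first exact/symfZ/symf1.
have [->|/hM ->] := eqVneq (k + delta i - delta j) 0; last by rewrite scale0r.
exact/hdegZ/hdeg1.
Qed.

Lemma arity0_deg k X : mxdeg k X ->
  forall i j, k + delta i - delta j != 0 -> arity0 X i j = 0.
Proof.
move=> hX i j ne; have [_ dX] := hX i j; rewrite mxE dX // deg_nil.
by apply: contraNneq ne; lia.
Qed.

Lemma arity0M X Y : arity0 (X * Y) = arity0 X * arity0 Y.
Proof.
apply/matrixP => i j; rewrite !mxE shuf_sumE; apply: eq_bigr => k _.
by rewrite shuf_mul_nil !mxE.
Qed.

Section Connection.
Variables (B : gbasis E) (D : W -> W).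
Hypothesis hD : dg_derivation D.

(** The sign of row i makes this a derivation for the plain matrix product: passing D over an entry
    X i a of a matrix of degree 0 turns the sign of row i into that of row a. *)
Definition nabla X : 'M[W]_n := \matrix_(i, j) (sg K (delta i) *: D (X i j)).

Lemma mxdeg_nabla k X : mxdeg k X -> mxdeg (k + 1) (nabla X).
Proof.
move=> hX i j; rewrite mxE; have [sX dX] := hX i j.
split; first exact/symfZ/(dgd_symf hD).
have := dgd_hdeg hD sX dX => /(hdegZ (sg K (delta i))).
by rewrite (_ : _ - _ + _ = k + 1 + delta i - delta j) //; lia.
Qed.

Lemma nablaM k X Y : mxdeg 0 X -> mxdeg k Y ->
  nabla (X * Y) = nabla X * Y + X * nabla Y.
Proof.
move=> hX hY; apply/matrixP => i j; rewrite !mxE -big_split.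
rewrite (lsymf_sum (dgd_lin hD)); last first.
  by move=> a _; apply: symfM; [case: (hX i a)|case: (hY a j)].
rewrite scaler_sumr; apply: eq_bigr => a _; rewrite !mxE /=.
have [sX dX] := hX i a; have [sY _] := hY a j.
rewrite (dgd_mul hD sX dX sY) scalerDr scalerAl -scalerAr; congr (_ + _).
by rewrite scalerA -sgD !sgE; congr ((-1) ^+ nat_of_bool _ *: _); lia.
Qed.

Lemma nablaB k X Y : mxdeg k X -> mxdeg k Y -> nabla (X - Y) = nabla X - nabla Y.
Proof.
move=> hX hY; apply/matrixP => i j; rewrite !mxE (lsymfB (dgd_lin hD)) ?scalerBr //.
  by case: (hX i j).
by case: (hY i j).
Qed.

Lemma nabla_cst (M : 'M[K]_n) : nabla (cst_mx M) = 0.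
Proof.
apply/matrixP => i j; rewrite !mxE (lsymfZ (dgd_lin hD)); last exact: symf1.
by rewrite (dgd1 hD) !scaler0.
Qed.

(** A constant matrix of degree -1 only relates degrees that differ by one, whose row signs are
    opposite. *)
Lemma nabla_cstM l (M : 'M[K]_n) X :
  (forall i j, -1 + delta i - delta j != 0 -> M i j = 0) -> mxdeg l X ->
  nabla (cst_mx M * X) = - (cst_mx M * nabla X).
Proof.
move=> hM hX; apply/matrixP => i j; rewrite !mxE (lsymf_sum (dgd_lin hD)); last first.
  move=> a _; apply: symfM; [rewrite mxE; exact/symfZ/symf1|by case: (hX a j)].
rewrite scaler_sumr -sumrN; apply: eq_bigr => a _; have [sX _] := hX a j.
rewrite !mxE -!scalerAl !mul1r (lsymfZ (dgd_lin hD)) // !scalerA -scaleNr.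
have [e|/hM ->] := eqVneq (-1 + delta i - delta a) 0; last by rewrite !(mulr0, mul0r) oppr0.
rewrite (_ : delta i = delta a + 1); last by lia.
by rewrite sgD sg1 mulrN1 mulNr mulrC.
Qed.

(** Leibniz gives k + 1 terms that cyclicity of the trace makes equal; the prefix X^l lets the
    induction absorb the factors already passed. *)
Lemma mxtrace_nabla_pow k l X : mxdeg 0 X ->
  \tr (X ^+ l * nabla (X ^+ k.+1)) = k.+1%:R *: \tr (X ^+ (l + k) * nabla X).
Proof.
move=> hX; elim: k l => [|k IH] l; first by rewrite addn0 scale1r.
rewrite exprS (nablaM hX (mxdegX k.+1 hX)) mulrDr mxtraceD [X ^+ l * (X * _)]mulrA.
rewrite -exprSr IH addSnnS -[k.+2]add1n natrD scalerDl scale1r; congr (_ + _).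
rewrite mulrA -mxtrace_commute; last 2 first.
- exact: mxdegX.
- by rewrite -[1]add0r; apply: mxdegM; [apply: mxdegX|apply: mxdeg_nabla hX].
by rewrite mulrA -exprD addnC.
Qed.

Lemma symf_ext (f : W) :
  (forall m, exists2 g, symf g & forall s, (size s <= m)%N -> f s = g s) -> symf f.
Proof.
move=> hf; split=> s1 s2 => [i a u v|x y].
  have [g sg fg] := hf (size s1 + (size s2).+1)%N.
  by rewrite !fg ?size_cat //; apply: (symf_linear sg).
have [g sg fg] := hf (size s1 + (size s2).+2)%N.
by rewrite !fg ?size_cat //; apply: (symf_swap sg).
Qed.

(** Signs occur in degree 0 but not in the trace of degree 1 matrices, because [nabla] already
    contains the sign of each row: see [dgd_supertr]. *)
Definition supertr X : W := \sum_i sg K (delta i) *: X i i.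

Lemma symf_supertr X : mxdeg 0 X -> symf (supertr X).
Proof. by move=> hX; apply: symf_sum => i _; apply: symfZ; case: (hX i i). Qed.

Lemma hdeg_supertr X : mxdeg 0 X -> hdeg 0 (supertr X).
Proof.
move=> hX; apply: hdeg_sum => i _; apply: hdegZ; case: (hX i i) => _.
by rewrite add0r subrr.
Qed.

Lemma vanish_supertr m X : mxvanish m X -> vanish m (supertr X).
Proof. by move=> hX; apply: vanish_sum => i _; apply: vanishZ. Qed.

Lemma dgd_supertr X : mxdeg 0 X -> D (supertr X) = \tr (nabla X).
Proof.
move=> hX; rewrite /supertr (lsymf_sum (dgd_lin hD)); last first.
  by move=> i _; apply: symfZ; case: (hX i i).
apply: eq_bigr => i _; rewrite mxE (lsymfZ (dgd_lin hD)) //.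
by case: (hX i i).
Qed.

(* [- supertr (log (1 - X))]; the powers beyond the arity do not contribute. *)
Definition log_series X : W := fun s =>
  \sum_(k < size s) k.+1%:R^-1 * supertr (X ^+ k.+1) s.

Definition log_sum X (m : nat) : W :=
  \sum_(k < m) k.+1%:R^-1 *: supertr (X ^+ k.+1).

Lemma log_seriesE X m s : mxvanish 1 X -> (size s <= m)%N ->
  log_series X s = log_sum X m s.
Proof.
move=> hX sm; rewrite /log_series /log_sum shuf_sumE.
rewrite -(subnKC sm) big_split_ord /= [X in _ = _ + X]big1 ?addr0 // => k _.
rewrite shufZE (vanish_supertr (mxvanishX hX)) ?mulr0 //=.
by rewrite ltnS leq_addr.
Qed.

Lemma symf_log_sum X m : mxdeg 0 X -> symf (log_sum X m).
Proof.
by move=> hX; apply: symf_sum => k _; apply/symfZ/symf_supertr/mxdegX.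
Qed.

Lemma symf_log_series X : mxdeg 0 X -> mxvanish 1 X -> symf (log_series X).
Proof.
move=> hX vX; apply: symf_ext => m; exists (log_sum X m).
  exact: symf_log_sum.
by move=> s; apply: log_seriesE.
Qed.

Lemma hdeg_log_series X : mxdeg 0 X -> mxvanish 1 X -> hdeg 0 (log_series X).
Proof.
move=> hX vX s hs; rewrite (log_seriesE vX (leqnn _)); move: (size s) => m; move: s hs.
by apply: hdeg_sum => k _; apply/hdegZ/hdeg_supertr/mxdegX.
Qed.

(** The derivative of - log (1 - X) is the geometric series in X, truncated here to the arities that
    s can see. *)
Lemma dgd_log_series X m s : mxdeg 0 X -> mxvanish 1 X -> (size s <= m)%N ->
  D (log_series X) s = \tr ((\sum_(k < m) X ^+ k) * nabla X) s.
Proof.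
move=> hX vX sm; have sL := symf_log_series hX vX; have sS := symf_log_sum m hX.
have -> : D (log_series X) s = D (log_sum X m) s.
  apply/eqP; rewrite -subr_eq0 -shufNE -shufDE -(lsymfB (dgd_lin hD)) //; apply/eqP.
  apply: (dgd_vanish B (m := m.+1) hD) => //; first exact: symfB.
  by move=> t tm; rewrite shufDE shufNE (log_seriesE (m := m) vX) ?subrr.
rewrite /log_sum (lsymf_sum (dgd_lin hD)); last first.
  by move=> k _; apply/symfZ/symf_supertr/mxdegX.
rewrite mulr_suml raddf_sum !shuf_sumE; apply: eq_bigr => k _.
rewrite (lsymfZ (dgd_lin hD)); last exact/symf_supertr/mxdegX.
rewrite (dgd_supertr (mxdegX _ hX)) -[nabla (X ^+ _)]mul1r -(expr0 X).
by rewrite mxtrace_nabla_pow // scalerA mulVf ?scale1r // pnatr_eq0.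
Qed.

(* With [g = 1 + h (A - A0)] one has [g A = nabla g + A0 g]: the connection [A] is
   gauge equivalent to its constant part, which is traceless, and the trace of
   [g^-1 (nabla g)] is the differential of the logarithm of the Berezinian of [g]. *)
Lemma mxtrace_exact A (h : 'M[K]_n) :
  mxdeg 1 A -> nabla A + A * A = 0 ->
  (forall i j, -1 + delta i - delta j != 0 -> h i j = 0) ->
  arity0 A * h + h * arity0 A = 1 ->
  exists L : W, [/\ symf L, L [::] = 0, hdeg 0 L & D L = \tr A].
Proof.
move=> dA MC hh hA; pose A0 := cst_mx (arity0 A); pose H := cst_mx h.
have dA0 : mxdeg 1 A0 by apply/mxdeg_cst/arity0_deg.
have dH : mxdeg (-1) H by apply: mxdeg_cst.
(* The arity 0 part of flatness, to which D contributes nothing. *)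
have A00 : A0 * A0 = 0.
  rewrite cst_mxM -arity0M; apply/matrixP => i j.
  have /matrixP/(_ i j) := MC; rewrite !mxE => /(congr1 (fun f : W => f [::])).
  rewrite shufDE shufZE (dgd_nil hD) ?mulr0 ?add0r => [->|]; first by rewrite scale0r.
  by case: (dA i j).
have HA : A0 * H + H * A0 = 1 by rewrite !cst_mxM cst_mxD hA cst_mx1.
pose N := H * (A0 - A).
have dN : mxdeg 0 N.
  by have := mxdegM dH (mxdegD dA0 (mxdegN dA)); rewrite addNr.
have vN : mxvanish 1 N.
  rewrite -[1%N]add0n; apply: mxvanishM => // i j; apply: vanish1.
  by rewrite !mxE shufDE shufNE shufZE shuf1E mulr1 subrr.
(* With g = 1 - N this reads nabla g = g A - A0 g. Flatness replaces nabla A by - A A, and the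
   homotopy identity moves A0 across H. *)
have gA : - nabla N = (1 - N) * A - A0 * (1 - N).
  rewrite /N (nabla_cstM hh (mxdegD dA0 (mxdegN dA))) -/H opprK.
  rewrite (nablaB dA0 dA) nabla_cst sub0r.
  have -> : nabla A = - (A * A) by apply/eqP; rewrite -addr_eq0 MC.
  have HA' : A0 * H = 1 - H * A0 by apply/eqP; rewrite eq_sym subr_eq HA.
  have E1 : A0 * (H * A0) = A0.
    by rewrite mulrA HA' mulrBl mul1r -mulrA A00 mulr0 subr0.
  have E2 : A0 * (H * A) = A - H * (A0 * A).
    by rewrite mulrA HA' mulrBl mul1r mulrA.
  rewrite opprK [in RHS]mulrBl mul1r [A0 * (1 - _)]mulrBr mulr1 -mulrA mulrBl.
  rewrite !mulrBr E1 E2 subKr opprB -addrA opprB addrA.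
  by rewrite -addrA subrKA addrC subrK.
exists (- log_series N); split.
- exact/symfN/symf_log_series.
- by rewrite shufNE /log_series big_ord0 oppr0.
- exact/hdegN/hdeg_log_series.
rewrite (lsymfN (dgd_lin hD)); last exact: symf_log_series.
apply/funext=> s; rewrite shufNE (dgd_log_series dN vN (leqnSn _)).
(* One more than the length of s, so that N^m vanishes on s and G acts there as the inverse of 1 -
   N. *)
set m := (size s).+1; set G := \sum_(k < m) _.
have dG : mxdeg 0 G.
  rewrite /G; elim/big_ind: _ => [i j|X Y|k _]; [|exact: mxdegD|exact: mxdegX].
  by rewrite mxE; split; [apply: symf0|apply: hdeg0].
have EG' : (1 - N) * G = 1 - N ^+ m.
  by rewrite -opprB mulNr -subrX1 opprB.
have EG : G * (1 - N) = 1 - N ^+ m.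
  rewrite -EG' mulrBr mulrBl mulr1 mul1r mulr_suml mulr_sumr; congr (_ - _).
  by apply: eq_bigr => k _; rewrite -exprS -exprSr.
have trA0 X : mxdeg 1 X -> \tr ((1 - N ^+ m) * X) s = \tr X s.
  move=> dX; rewrite mulrBl mul1r raddfB shufDE shufNE.
  rewrite [X in _ - X](vanish_mxtrace (m := m)) ?subr0 //.
  have vX : mxvanish 0 X by [].
  by have := mxvanishM (mxvanishX (k := m) vN) vX; rewrite addn0.
rewrite -shufNE -raddfN -mulrN gA mulrBr raddfB /= shufDE shufNE mulrA EG trA0 //.
(* Cyclicity brings 1 - N next to G and leaves the trace of A0, which is zero: a diagonal entry of A
   has degree 1, hence no constant term. *)
rewrite mulrA -mxtrace_commute; last 2 first.
- by apply: mxdegD; [apply: mxdeg1|apply: mxdegN].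
- by have := mxdegM dG dA0; rewrite add0r.
rewrite mulrA EG' trA0 // (_ : \tr A0 = 0) ?subr0 // /mxtrace big1 // => i _.
by rewrite mxE (arity0_deg dA) ?scale0r // addrK.
Qed.

End Connection.
End SuperMatrices.

(** * Connection and Jacobian matrices *)

Section ChainRule.
Variables (K : numFieldType) (E : gradedVect K) (B : gbasis E).
Local Notation W := (shuf E).
Local Notation xi := (gco B).
Local Notation evec i := (hom_of (gvec B i)).

Lemma dr0 x : dr x (0 : W) = 0. Proof. by []. Qed.

Lemma dr1 x : dr x (1 : W) = 0.
Proof. by apply/funext=> s; rewrite /dr shuf1E; case: s. Qed.

Lemma dr_gcoM i j (g : W) : dr (evec i) (xi j * g) =
  (j == i)%:R *: g + sg K (gdeg B i * gdeg B j) *: (xi j * dr (evec i) g).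
Proof.
rewrite dr_mul dr_gco -scalerAl mul1r (tw_hdeg _ (gco_hdeg B j)) -scalerAl.
by rewrite mulrN sgN.
Qed.

Section Derivation.
Variable D : W -> W.
Hypothesis hD : dg_derivation D.

Definition conn : 'M[W]_(gdim B) := \matrix_(i, j) dr (evec i) (D (xi j)).

Lemma mxdeg_conn : mxdeg (gdeg B) 1 conn.
Proof.
move=> i j; rewrite mxE; split; first exact/symf_dr/(dgd_symf hD)/gco_symf.
have := hdeg_dr (x := evec i) (dgd_hdeg hD (gco_symf B j) (gco_hdeg B j)).
by rewrite (_ : _ + tag _ = 1 + gdeg B i - gdeg B j) //=; lia.
Qed.

(** The signed commutator of D with the derivative along e_i and the combination of partial
    derivatives with coefficients [conn i k] are derivations that agree on generators;
    [symf_ind_null] compares them. *)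
Lemma chain_derivation i f : symf f -> dr (evec i) (D f) =
  sg K (gdeg B i) *: D (dr (evec i) f) + \sum_k conn i k * dr (evec k) f.
Proof.
move=> hf; apply/eqP; rewrite -subr_eq0; apply/eqP.
pose C (f : W) : W := dr (evec i) (D f) -
  (sg K (gdeg B i) *: D (dr (evec i) f) + \sum_k conn i k * dr (evec k) f).
rewrite -/(C f); apply: (symf_ind_null _ (B := B)) => //.
- move=> a u v hu hv; rewrite /C (dgd_lin hD) // !drD !drZ.
  rewrite (dgd_lin hD); try exact: symf_dr.
  rewrite (eq_bigr (fun k => a *: (conn i k * dr (evec k) u) + conn i k * dr (evec k) v));
    last by move=> k _; rewrite drD drZ mulrDr -scalerAr.
  rewrite big_split -scaler_sumr /=.
  apply/funext=> s; rewrite !(shufDE, shufNE, shufZE); ring.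
- rewrite /C (dgd1 hD) dr1 (lsymf0 (dgd_lin hD)) scaler0 !add0r.
  rewrite big1 ?oppr0 // => k _.
  by rewrite dr1 mulr0.
(* The sign of moving an operator of degree gdeg B i + 1 past xi_j. *)
move=> j g hg; exists (sg K (gdeg B j + gdeg B i * gdeg B j) *: xi j).
  by rewrite shufZE gco_nil mulr0.
have sxg : symf (xi j * dr (evec i) g) by apply/symfM/symf_dr => //; apply: gco_symf.
rewrite /C (dgd_mul hD (gco_symf B j) (gco_hdeg B j) hg) drD drZ [dr _ (D _ * _)]dr_mul !dr_gcoM.
rewrite (dgd_lin hD) ?(lsymfZ (dgd_lin hD)) //; last exact: symfZ.
rewrite (dgd_mul hD (gco_symf B j) (gco_hdeg B j)); last exact: symf_dr.
rewrite (tw_hdeg _ (dgd_hdeg hD (gco_symf B j) (gco_hdeg B j))) /=.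
rewrite (eq_bigr (fun k => (j == k)%:R *: (conn i k * g) +
    sg K (gdeg B j + gdeg B i * gdeg B j) *: (xi j * (conn i k * dr (evec k) g)))); last first.
  move=> k _; rewrite dr_gcoM mulrDr -!scalerAr !mulrA; congr (_ + _).
  rewrite (mulC_hdeg (mxdeg_conn i k).2 (gco_hdeg B j)) -scalerAl scalerA -sgD.
  rewrite !sgE; congr ((-1) ^+ nat_of_bool _ *: _).
  by rewrite !(oddzD, abszM, oddM, abszN) /=; do 3!case: (odd _).
rewrite big_split -scaler_sumr -mulr_sumr (bigD1 j) //= eqxx scale1r big1 ?addr0; last first.
  by move=> k /negPf; rewrite eq_sym => ->; rewrite scale0r.
rewrite [conn i j]mxE !mulrDr !scalerDr !scalerA sgN.
set S := \sum_k _.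
have -> : sg K (gdeg B i * - gdeg B j + gdeg B i * 1) =
    sg K (gdeg B i) * sg K (gdeg B i * gdeg B j).
  by rewrite mulr1 addrC sgD mulrN sgN.
rewrite sgD -!scalerAl mulrN mulrDr -!scalerAr.
have -> : sg K (gdeg B j) * (j == i)%:R = sg K (gdeg B i) * (j == i)%:R.
  by have [->|] := eqVneq j i; rewrite ?mulr0.
apply/funext=> s; rewrite !(shufDE, shufNE, shufZE); ring.
Qed.

(** The chain rule applied to D xi_j, which D kills. *)
Lemma conn_flat : nabla (gdeg B) D conn + conn * conn = 0.
Proof.
apply/matrixP => i j; rewrite !mxE.
have sx := dgd_symf hD (gco_symf B j).
have := chain_derivation i sx; rewrite (dgd_sq hD (gco_symf B j)).
rewrite dr0 => e; rewrite [RHS]e; congr (_ + _).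
by apply: eq_bigr => k _; rewrite !mxE.
Qed.

(** The chain rule in arity 0: on single letters only the linear part of D acts. *)
Lemma dgd_letter f i : symf f ->
  D f [:: evec i] = \sum_k arity0 conn i k * f [:: evec k].
Proof.
move=> hf; have /(congr1 (fun g : W => g [::])) := chain_derivation i hf.
rewrite /dr /= shufDE shufZE (dgd_nil hD) ?mulr0 ?add0r; last exact: symf_dr.
move=> ->; rewrite shuf_sumE; apply: eq_bigr => k _.
by rewrite shuf_mul_nil [arity0 _ _ _]mxE.
Qed.

End Derivation.
End ChainRule.

Section Jacobian.
Variables (K : numFieldType) (E F : gradedVect K) (B : gbasis E) (C : gbasis F).
Variables (DE : shuf E -> shuf E) (DF : shuf F -> shuf F) (P : shuf F -> shuf E).
Hypotheses (hDE : dg_derivation DE) (hDF : dg_derivation DF).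
Hypothesis hP : dg_morphism DE DF P.
Local Notation evec a := (hom_of (gvec B a)).
Local Notation fvec i := (hom_of (gvec C i)).

Definition jac : 'M[shuf E]_(gdim B, gdim C) := \matrix_(a, i) dr (evec a) (P (gco C i)).

Lemma jac_deg a i : symf (jac a i) /\ hdeg (gdeg B a - gdeg C i) (jac a i).
Proof.
rewrite mxE; split; first exact/symf_dr/(dgm_symf hP)/gco_symf.
have := hdeg_dr (x := evec a) (dgm_hdeg hP (gco_symf C i) (gco_hdeg C i)).
by rewrite addrC.
Qed.

(** Again the two sides agree on generators and satisfy the same Leibniz rule over P, so
    [symf_ind_null] applies. *)
Lemma chain_morphism a f : symf f ->
  dr (evec a) (P f) = \sum_i jac a i * P (dr (fvec i) f).
Proof.
move=> hf; apply/eqP; rewrite -subr_eq0; apply/eqP.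
pose G (f : shuf F) : shuf E := dr (evec a) (P f) - \sum_i jac a i * P (dr (fvec i) f).
rewrite -/(G f); apply: (symf_ind_null _ (B := C)) => //.
- move=> c u v hu hv; rewrite /G (dgm_lin hP) // !drD !drZ.
  rewrite (eq_bigr (fun k => c *: (jac a k * P (dr (fvec k) u)) +
    jac a k * P (dr (fvec k) v))); last first.
    by move=> k _; rewrite drD drZ (dgm_lin hP) ?mulrDr -?scalerAr //; apply: symf_dr.
  rewrite big_split -scaler_sumr /=.
  apply/funext=> s; rewrite !(shufDE, shufNE, shufZE); ring.
- rewrite /G (dgm1 hP) dr1 sub0r big1 ?oppr0 // => k _.
  by rewrite dr1 (lsymf0 (dgm_lin hP)) mulr0.
move=> j g hg; exists (sg K (gdeg B a * gdeg C j) *: P (gco C j)).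
  by rewrite shufZE (dgm_nil hP (gco_symf C j)) gco_nil mulr0.
rewrite /G (dgm_mul hP (gco_symf C j) hg) dr_mul.
rewrite (tw_hdeg _ (dgm_hdeg hP (gco_symf C j) (gco_hdeg C j))) mulrN sgN /=.
rewrite (eq_bigr (fun k => (j == k)%:R *: (jac a k * P g) +
    sg K (gdeg B a * gdeg C j) *: (P (gco C j) * (jac a k * P (dr (fvec k) g))))); last first.
  move=> k _; rewrite dr_gcoM.
  have sd : symf (dr (fvec k) g) by apply: symf_dr.
  have sm : symf (gco C j * dr (fvec k) g) by apply: symfM => //; apply: gco_symf.
  rewrite (dgm_lin hP) // ?(lsymfZ (dgm_lin hP)) //; last exact: symfZ.
  rewrite (dgm_mul hP (gco_symf C j) sd) mulrDr -!scalerAr !mulrA; congr (_ + _).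
  rewrite (mulC_hdeg (jac_deg a k).2 (dgm_hdeg hP (gco_symf C j) (gco_hdeg C j))).
  rewrite -scalerAl scalerA -sgD.
  rewrite !sgE; congr ((-1) ^+ nat_of_bool _ *: _).
  by rewrite !(oddzD, abszM, oddM, abszN) /=; do 3!case: (odd _).
rewrite big_split -scaler_sumr -mulr_sumr (bigD1 j) //= eqxx scale1r big1 ?addr0; last first.
  by move=> k /negPf; rewrite eq_sym => ->; rewrite scale0r.
rewrite [jac a j]mxE -!scalerAl mulrBr.
apply/funext=> s; rewrite !(shufDE, shufNE, shufZE); ring.
Qed.

Lemma dgm_letter f a : symf f ->
  P f [:: evec a] = \sum_k jac a k [::] * f [:: fvec k].
Proof.
move=> hf; have /(congr1 (fun g : shuf E => g [::])) := chain_morphism a hf.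
rewrite {1}/dr /= => ->; rewrite shuf_sumE; apply: eq_bigr => k _.
by rewrite shuf_mul_nil (dgm_nil hP) //; apply: symf_dr.
Qed.

(** Differentiate P (DF xi_i) = DE (P xi_i) along e_a, using the chain rule of each side. *)
Lemma jac_intertwines a i : sg K (gdeg B a) *: DE (jac a i) +
    \sum_b conn B DE a b * jac b i = \sum_k jac a k * P (conn C DF k i).
Proof.
have sx := dgd_symf hDF (gco_symf C i).
have := chain_morphism a sx; rewrite (dgm_diff hP (gco_symf C i)).
rewrite (chain_derivation hDE _ (dgm_symf hP (gco_symf C i))) => e.
rewrite [jac a i]mxE [X in _ + X](eq_bigr (fun b => conn B DE a b *
  dr (evec b) (P (gco C i)))); last by move=> b _; rewrite [jac b i]mxE.
by rewrite e; apply: eq_bigr => k _; rewrite [conn C DF k i]mxE.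
Qed.

End Jacobian.

(** * The mapping cone *)

Section Contraction.
Variable K : fieldType.

(** With M p M = M, the rows of 1 - M p are cycles, hence boundaries; so h = (1 - M p) p satisfies h
    M = 1 - M p, while M M = 0 gives M h = M p. *)
Lemma acyclic_contraction n (M : 'M[K]_n) : M *m M = 0 -> (kermx M <= M)%MS ->
  exists h : 'M[K]_n, M *m h + h *m M = 1%:M.
Proof.
move=> MM kM; pose p := pinvmx M.
have MpM : M *m p *m M = M by apply: mulmxKpV.
have E : (1%:M - M *m p) *m p *m M = 1%:M - M *m p.
  apply: mulmxKpV; apply: submx_trans kM; apply/sub_kermxP.
  by rewrite mulmxBl mul1mx MpM subrr.
exists ((1%:M - M *m p) *m p); rewrite E.
by rewrite mulmxA mulmxBr mulmx1 [M *m (M *m p)]mulmxA MM mul0mx subr0 addrC subrK.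
Qed.

(* [a] and [b] are the differentials of two complexes, acting on row vectors;
   the last two hypotheses say that [j] and [k] are inverse to each other in
   homology, and the conclusion that the mapping cone of [j] is acyclic. *)
Lemma cone_acyclic n m (a : 'M[K]_n) (b : 'M[K]_m) (j : 'M[K]_(n, m)) (k : 'M[K]_(m, n)) :
  b *m b = 0 -> a *m j = j *m b -> b *m k = k *m a ->
  kermx a *m (j *m k - 1%:M) *m cokermx a = 0 ->
  kermx b *m (k *m j - 1%:M) *m cokermx b = 0 ->
  (kermx (block_mx a j 0 (- b)) <= block_mx a j 0 (- b))%MS.
Proof.
move=> bb aj bk ha hb; set M := block_mx _ _ _ _; set V := kermx M.
have : V *m M = 0 by apply: mulmx_ker.
rewrite -[V in V *m M]hsubmxK /M mul_row_block mulmx0 addr0 mulmxN.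
set x := lsubmx V; set y := rsubmx V => /eqP.
rewrite row_mx_eq0 => /andP[/eqP xa /eqP xj].
have {}xj : x *m j = y *m b by apply/eqP; rewrite -subr_eq0 xj.
(* Rows of [kermx d] span the cycles and [cokermx d] tests for boundaries: a map c that is zero in
   homology sends each cycle to a boundary. *)
have quasi p q (u : 'M[K]_(p, q)) (d c : 'M[K]_q) : u *m d = 0 ->
    kermx d *m c *m cokermx d = 0 -> exists w, u *m c = w *m d.
  move=> /sub_kermxP/submxP[w ->] e; apply/submxP; rewrite submxE.
  have -> : w *m kermx d *m c *m cokermx d = w *m (kermx d *m c *m cokermx d).
    by rewrite !mulmxA.
  by rewrite e mulmx0.
have [w ew] := quasi _ _ x a _ xa ha.
(* The image of x under j bounds y, and x j k is homologous to x, so that x itself bounds. *)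
pose u := y *m k - w.
have ua : u *m a = x.
  rewrite mulmxBl -mulmxA -bk mulmxA -xj -mulmxA -ew mulmxBr mulmx1.
  by rewrite opprB addrC subrK.
pose y' := y - u *m j.
have yb : y' *m b = 0 by rewrite mulmxBl -mulmxA -aj mulmxA ua xj subrr.
have [t et] := quasi _ _ y' b _ yb hb.
(* The pair (u, 0) misses (x, y) by the cycle y' in the second component; y' k corrects this up to
   the boundary of t. *)
apply/submxP; exists (row_mx (u + y' *m k) t).
rewrite mul_row_block mulmx0 addr0 mulmxN -[V]hsubmxK -/x -/y; congr row_mx.
  by rewrite mulmxDl ua -mulmxA -bk mulmxA yb mul0mx addr0.
rewrite -et mulmxBr mulmx1 mulmxDl -mulmxA opprB /y'.
by rewrite addrA addrAC addrK addrC subrK.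
Qed.

End Contraction.

Section Cone.
Variables (K : numFieldType) (E F : gradedVect K) (B : gbasis E) (C : gbasis F).
Variables (DE : shuf E -> shuf E) (DF : shuf F -> shuf F) (P : shuf F -> shuf E).
Hypotheses (hDE : dg_derivation DE) (hDF : dg_derivation DF).
Hypothesis hP : dg_morphism DE DF P.

Let M : 'M[shuf E]_(gdim B + gdim C) :=
  block_mx (conn B DE) (jac B C P) 0 (- map_mx P (conn C DF)).

(** Shifting the generators of F by one gives the Jacobian degree 1, like the two connections. *)
Let delta (k : 'I_(gdim B + gdim C)) : int :=
  match fintype.split k with inl a => gdeg B a | inr i => gdeg C i + 1 end.

Let delta_l a : delta (lshift _ a) = gdeg B a.
Proof. by rewrite /delta (unsplitK (inl a)). Qed.
Let delta_r i : delta (rshift _ i) = gdeg C i + 1.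
Proof. by rewrite /delta (unsplitK (inr i)). Qed.

Lemma cone_deg : mxdeg delta 1 M.
Proof.
move=> k l; case: (split_ordP k) => a ->; case: (split_ordP l) => b ->;
  rewrite ?(block_mxEul, block_mxEur, block_mxEdl, block_mxEdr) ?delta_l ?delta_r.
- exact: mxdeg_conn.
- have [sJ dJ] := jac_deg hP a b; split=> //; move: dJ.
  by rewrite (_ : _ - _ = 1 + gdeg B a - (gdeg C b + 1)) //; lia.
- by rewrite mxE; split; [apply: symf0|apply: hdeg0].
- rewrite mxE mxE; have [sA dA] := mxdeg_conn hDF a b.
  split; first exact/symfN/(dgm_symf hP).
  apply: hdegN; have := dgm_hdeg hP sA dA.
  by rewrite (_ : _ - _ = 1 + (gdeg C a + 1) - (gdeg C b + 1)) //; lia.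
Qed.

(** The diagonal blocks are [conn_flat] for E and the image under P of [conn_flat] for F, and the
    upper right block is [jac_intertwines]. The shift of F changes its row signs, which offsets the
    minus sign in the last block. *)
Lemma cone_flat : nabla delta DE M + M * M = 0.
Proof.
have nM : nabla delta DE M = block_mx (nabla (gdeg B) DE (conn B DE))
    (\matrix_(a, i) (sg K (gdeg B a) *: DE (jac B C P a i))) 0
    (map_mx P (nabla (gdeg C) DF (conn C DF))).
  apply/matrixP => k l; rewrite mxE.
  case: (split_ordP k) => a ->; case: (split_ordP l) => b ->;
  rewrite ?(block_mxEul, block_mxEur, block_mxEdl, block_mxEdr) ?delta_l ?delta_r !mxE //.
    by rewrite (lsymf0 (dgd_lin hDE)) scaler0.
  have sx := dgd_symf hDF (gco_symf C b).
  have sd x : symf (dr x (DF (gco C b))) by apply: symf_dr.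
  rewrite (lsymfN (dgd_lin hDE)); last exact: (dgm_symf hP).
  rewrite (lsymfZ (dgm_lin hP)); last exact: (dgd_symf hDF).
  by rewrite (dgm_diff hP) // sgD sg1 mulrN1 scaleNr scalerN opprK.
rewrite nM -mulmxE mulmx_block !mulmx0 !mul0mx !addr0 !add0r add_block_mx addr0.
rewrite mulmxE (conn_flat _ hDE) -[RHS]block_mx0; congr block_mx.
  apply/matrixP => a i; rewrite !mxE.
  have e := jac_intertwines hDE hDF hP a i.
  rewrite addrA [X in X + _ = _](_ : _ = \sum_k jac B C P a k * P (conn C DF k i)).
    by rewrite -big_split big1 // => k _; rewrite !mxE mulrN /= subrr.
  by rewrite -e mxE.
apply/matrixP => a i; rewrite !mxE.
have sC p q : symf (conn C DF p q) by case: (mxdeg_conn hDF p q).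
have /matrixP/(_ a i) := conn_flat C hDF.
rewrite !mxE => /eqP; rewrite addr_eq0 => /eqP ->.
rewrite (lsymfN (dgm_lin hP)); last by apply: symf_sum => k _; apply: symfM.
rewrite (lsymf_sum (dgm_lin hP)); last by move=> k _; apply: symfM.
rewrite -sumrN -big_split big1 // => k _ /=.
have oM p q : (- map_mx P (conn C DF)) p q = - P (conn C DF p q).
  by rewrite mxE mxE.
by rewrite (dgm_mul hP) // !oM mulrNN addNr.
Qed.

Lemma mxtrace_cone : \tr M = \tr (conn B DE) - P (\tr (conn C DF)).
Proof.
rewrite mxtrace_block raddfN /=; congr (_ - _).
rewrite (lsymf_sum (dgm_lin hP)); first by apply: eq_bigr => i _; rewrite mxE.
by move=> i _; case: (mxdeg_conn hDF i i).
Qed.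

Let a := arity0 (conn B DE).
Let b := arity0 (conn C DF).
Let j : 'M[K]_(gdim B, gdim C) := \matrix_(i, k) jac B C P i k [::].

Lemma arity0_cone : arity0 M = block_mx a j 0 (- b).
Proof.
apply/matrixP => k l; rewrite mxE.
case: (split_ordP k) => p ->; case: (split_ordP l) => q ->;
  rewrite ?(block_mxEul, block_mxEur, block_mxEdl, block_mxEdr) !mxE //.
rewrite shufNE (dgm_nil hP) //.
by have [] := mxdeg_conn hDF p q; rewrite mxE.
Qed.

Lemma arity0_flat n d (D : shuf E -> shuf E) (X : 'M[shuf E]_n) :
  dg_derivation D -> (forall i l, symf (X i l)) -> nabla d D X + X * X = 0 ->
  arity0 X *m arity0 X = 0.
Proof.
move=> hD hX MC; rewrite mulmxE -arity0M; apply/matrixP => i l.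
have /matrixP/(_ i l) := MC; rewrite !mxE => /(congr1 (fun f : shuf E => f [::])).
by rewrite shufDE shufZE (dgd_nil hD) ?mulr0 ?add0r.
Qed.

Lemma dg_morphism_trace : (kermx (block_mx a j 0 (- b)) <= block_mx a j 0 (- b))%MS ->
  exists L : shuf E, [/\ symf L, L [::] = 0, hdeg 0 L &
    DE L = \tr (conn B DE) - P (\tr (conn C DF))].
Proof.
rewrite -arity0_cone => acyc; rewrite -mxtrace_cone.
have M00 : arity0 M *m arity0 M = 0.
  by apply: arity0_flat hDE _ cone_flat => i l; case: (cone_deg i l).
have [h hh] := acyclic_contraction M00 acyc.
(* The component of degree -1 of a contraction is still a contraction. *)
pose h' : 'M[K]_(gdim B + gdim C) :=
  \matrix_(i, l) if -1 + delta i - delta l == 0 then h i l else 0.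
apply: (mxtrace_exact B hDE (delta := delta) cone_deg cone_flat (h := h')).
  by move=> i l /negPf ne; rewrite mxE ne.
have M0 := arity0_deg cone_deg.
apply/matrixP => i l; rewrite !mxE.
(* As [arity0 M] has degree 1, entries between equal degrees only involve the component of h of
   degree -1; with h', entries between distinct degrees vanish. *)
have [eil|neil] := eqVneq (delta i) (delta l).
  have /matrixP/(_ i l) := hh; rewrite !mxE => <-; congr (_ + _).
    apply: eq_bigr => k _; rewrite [h' _ _]mxE.
    have [//|/eqP ne] := eqVneq (-1 + delta k - delta l) 0.
    by rewrite M0 ?mul0r //; apply/eqP; lia.
  apply: eq_bigr => k _; rewrite [h' _ _]mxE.
  have [//|/eqP ne] := eqVneq (-1 + delta i - delta k) 0.
  by rewrite mul0r M0 ?mulr0 //; apply/eqP; lia.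
have -> : i == l = false by apply: contraNF neil => /eqP ->.
rewrite !big1 ?addr0 // => k _; rewrite [h' _ _]mxE; case: ifP => [/eqP e|_];
  rewrite ?mulr0 ?mul0r //; rewrite M0 ?mulr0 ?mul0r //;
  by apply: contraNneq neil => e'; apply/eqP; lia.
Qed.

End Cone.

(** * Homotopies on linear parts *)

Import numFieldNormedType.Exports.

Section ScalarCurves.
Variables (R : realType) (c : ground).
Implicit Types x y : scalars R c.

Lemma sc_reD x y : sc_re (x + y) = sc_re x + sc_re y.
Proof. by case: c x y => [|] // [xr xi] [yr yi]. Qed.

Lemma sc_imD x y : sc_im (x + y) = sc_im x + sc_im y.
Proof. by case: c x y => [x y|[xr xi] [yr yi]] //=; rewrite addr0. Qed.

Lemma sc_reM x y : sc_re (x * y) = sc_re x * sc_re y - sc_im x * sc_im y.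
Proof. by case: c x y => [x y|[xr xi] [yr yi]] //=; rewrite mul0r subr0. Qed.

Lemma sc_imM x y : sc_im (x * y) = sc_re x * sc_im y + sc_im x * sc_re y.
Proof. by case: c x y => [x y|[xr xi] [yr yi]] //=; rewrite mulr0 mul0r addr0. Qed.

Lemma sc_re0 : sc_re (0 : scalars R c) = 0. Proof. by case: c. Qed.
Lemma sc_im0 : sc_im (0 : scalars R c) = 0. Proof. by case: c. Qed.

Lemma sc_re_sum (I : Type) (r : seq I) (F : I -> scalars R c) :
  sc_re (\sum_(i <- r) F i) = \sum_(i <- r) sc_re (F i).
Proof. exact: (big_morph _ sc_reD sc_re0). Qed.

Lemma sc_im_sum (I : Type) (r : seq I) (F : I -> scalars R c) :
  sc_im (\sum_(i <- r) F i) = \sum_(i <- r) sc_im (F i).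
Proof. exact: (big_morph _ sc_imD sc_im0). Qed.

Lemma sc_ext x y : sc_re x = sc_re y -> sc_im x = sc_im y -> x = y.
Proof. by case: c x y => [x y //|[xr xi] [yr yi]] /= -> ->. Qed.

Lemma sc_re_ddt (g : R -> scalars R c) t : sc_re (ddt g t) = derive1 (@sc_re R c \o g) t.
Proof. by rewrite /ddt; case: c g. Qed.

Lemma sc_im_ddt (g : R -> scalars R c) t : sc_im (ddt g t) = derive1 (@sc_im R c \o g) t.
Proof.
rewrite /ddt; case: c g => //= g; symmetry.
by rewrite (_ : _ \o _ = cst 0) ?derive1_cst.
Qed.

Lemma smooth_is_derive (g : R -> scalars R c) t : smooth g ->
  is_derive t (1 : R) (@sc_re R c \o g) (sc_re (ddt g t)) /\
  is_derive t (1 : R) (@sc_im R c \o g) (sc_im (ddt g t)).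
Proof.
move=> [/(_ 0%N t) hr /(_ 0%N t) hi]; rewrite sc_re_ddt sc_im_ddt !derive1E.
by split; apply: DeriveDef.
Qed.

Lemma eq_ends_of_derive0 (f df : R -> R) :
  (forall t, is_derive t (1 : R) f (df t)) ->
  (forall t, 0 <= t <= 1 -> df t = 0) -> f 0 = f 1.
Proof.
move=> hf h0.
have [t] : exists2 t, t \in `]0, 1[%R & f 1 - f 0 = df t * (1 - 0).
  apply: MVT => //.
  by apply: derivable_within_continuous => t _; case: (hf t).
rewrite in_itv /= => /andP[t0 t1]; rewrite h0 ?(ltW t0) ?(ltW t1) // mul0r => /eqP.
by rewrite subr_eq0 => /eqP.
Qed.

Lemma eq_ends_sum n (h dh : 'I_n -> R -> R) :
  (forall i t, is_derive t (1 : R) (h i) (dh i t)) ->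
  (forall t, 0 <= t <= 1 -> \sum_i dh i t = 0) -> \sum_i h i 0 = \sum_i h i 1.
Proof.
move=> hh h0; have : (\sum_i h i) 0 = (\sum_i h i) 1; last by rewrite !fct_sumE.
exact: (eq_ends_of_derive0 (df := fun t => \sum_i dh i t)).
Qed.

(** The mean value theorem is for real functions, hence the split into real and imaginary parts. *)
Lemma eq_ends_of_ddt0 n (x : 'I_n -> scalars R c) (u : 'I_n -> R -> scalars R c) :
  (forall i, smooth (u i)) ->
  (forall t, 0 <= t <= 1 -> \sum_i x i * ddt (u i) t = 0) ->
  \sum_i x i * u i 0 = \sum_i x i * u i 1.
Proof.
move=> su h0; apply: sc_ext; rewrite ?sc_re_sum ?sc_im_sum.
  under eq_bigr do rewrite sc_reM; under [RHS]eq_bigr do rewrite sc_reM.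
  apply: (eq_ends_sum
    (h := fun i => sc_re (x i) \*: (@sc_re R c \o u i) - sc_im (x i) \*: (@sc_im R c \o u i))
    (dh := fun i t => sc_re (x i) *: sc_re (ddt (u i) t) - sc_im (x i) *: sc_im (ddt (u i) t))).
    by move=> i t; have [hr hi] := smooth_is_derive t (su i); apply: is_deriveB.
  move=> t /h0/(congr1 (@sc_re R c)); rewrite sc_re_sum sc_re0 => e; rewrite -[RHS]e.
  by apply: eq_bigr => i _; rewrite sc_reM.
under eq_bigr do rewrite sc_imM; under [RHS]eq_bigr do rewrite sc_imM.
apply: (eq_ends_sum
  (h := fun i => sc_re (x i) \*: (@sc_im R c \o u i) + sc_im (x i) \*: (@sc_re R c \o u i))
  (dh := fun i t => sc_re (x i) *: sc_im (ddt (u i) t) + sc_im (x i) *: sc_re (ddt (u i) t))).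
  by move=> i t; have [hr hi] := smooth_is_derive t (su i); apply: is_deriveD.
move=> t /h0/(congr1 (@sc_im R c)); rewrite sc_im_sum sc_im0 => e; rewrite -[RHS]e.
by apply: eq_bigr => i _; rewrite sc_imM.
Qed.

End ScalarCurves.

Section HomotopyHomology.
Variables (R : realType) (c : ground) (E : lieInfty (scalars R c)).
Local Notation K := (scalars R c).
Variables (B : gbasis E) (Q : cochain E -> cochain E) (P : cochain E -> cochain E).
Variable Xi : cochain E -> dRform E.
Hypothesis hQ : is_differential Q.
Hypothesis hXi : is_homotopy Q Q P id Xi.
Local Notation W := (shuf E).
Local Notation xi := (gco B).
Local Notation evec i := (hom_of (gvec B i)).
Local Notation a := (arity0 (conn B (Q \o @aug _ E))).

Lemma fun_mul_letter (f g : cochain E) x : fun_mul f g [:: x] = 0.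
Proof. by rewrite /fun_mul big_geq. Qed.

Lemma symf_fun (f : W) : symf f -> f [::] = 0 -> is_function f.
Proof. by move=> hf f0; apply/is_functionP. Qed.

Lemma homotopy_arity2 t (f : W) x : 0 <= t <= 1 -> symf f -> vanish 2 f ->
  (Xi f).2 t [:: x] = 0.
Proof.
(* [f] is a sum of products, and a product has no component of arity 1. *)
move=> ht hf v2.
pose H (f : W) : W := (Xi (aug f)).2 t.
have Hlin : linear_on_symf H.
  move=> k u v hu hv; rewrite /H aug_lin.
  by have [_ ->] := homotopy_linear hXi k (aug_fun hu) (aug_fun hv) ht.
rewrite -{1}(@aug_id _ _ f) ?v2 // -/(H f).
have [g [hg vg ->]] := symf_decomp B hf.
have sg0 i : symf (xi i * g i) by apply: symfM => //; apply: gco_symf.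
rewrite v2 // scale0r add0r (lsymf_sum Hlin) // shuf_sumE big1 // => i _.
have gi0 : g i [::] = 0 by apply: vg v2 i _ _.
rewrite /H aug_id ?shuf_mul_nil ?gco_nil ?mul0r // -fun_mulE ?gco_nil //.
have [_ ->] := homotopy_mul hXi (symf_fun (gco_symf B i) (gco_nil i))
  (symf_fun (hg i) gi0) ht.
by rewrite /= !fun_mul_letter addr0.
Qed.

(** The dt component of the homotopy equation in arity 1. Since Q f starts in arity 2, its image
    contributes nothing, and the derivative is, up to sign, the linear part of Q applied to the dt
    component of Xi f. *)
Lemma homotopy_derivative t (f : W) i : 0 <= t <= 1 -> symf f -> f [::] = 0 ->
  (forall l, Q f [:: evec l] = 0) ->
  sg K (gdeg B i) * ddt (fun u => (Xi f).1 u [:: evec i]) t =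
    - \sum_l a i l * (Xi f).2 t [:: evec l].
Proof.
move=> ht hf f0 Qf0; have ff := symf_fun hf f0.
have /is_functionP[sQ Q0] := differential_fun hQ ff.
have v2 : vanish 2 (Q f : W).
  move=> [|x [|y s]] //= _.
  by rewrite -[[:: x]]/(rcons [::] x) (gco_expand B) // big1 // => l _; rewrite Qf0 mulr0.
have [_ /(congr1 (fun g : cochain E => g [:: evec i]))] := homotopy_differential hXi ff ht.
rewrite (homotopy_arity2 _ ht sQ v2) /= /fun_sign.
have [_ [hH _]] := homotopy_form hXi ff; have /is_functionP[sH H0] := hH t ht.
have := dgd_letter (is_differential_dg hQ) (B := B) i sH.
rewrite /= (aug_id H0) => ->.
rewrite deg_cons deg_nil addr0 => /esym/eqP; rewrite addrC addr_eq0 => /eqP.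
by [].
Qed.

(** Each entry pairs a cycle x, a row of [kermx a], with P f - f for a linear cocycle f, a column of
    [cokermx a]. Along the homotopy the derivative of this pairing is that of x with a
    coboundary. *)
Lemma homotopy_homology :
  kermx a *m (\matrix_(i, l) P (xi l) [:: evec i] - 1%:M) *m cokermx a = 0.
Proof.
have hD := is_differential_dg hQ.
have x0 l : (xi l : W) [::] = 0 by apply: gco_nil.
have a0 := arity0_deg (mxdeg_conn (B := B) hD).
apply/matrixP => r s; rewrite [RHS]mxE.
pose x : 'rV[K]_(gdim B) := delta_mx 0 r *m kermx a.
pose y : 'cV[K]_(gdim B) := cokermx a *m delta_mx s 0.
have xa : x *m a = 0 by rewrite -mulmxA mulmx_ker mulmx0.
have ay : a *m y = 0 by rewrite mulmxA mulmx_coker mul0mx.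
pose f : W := \sum_l y l 0 *: xi l.
have sf : symf f by apply: symf_sum => l _; apply/symfZ/gco_symf.
have f0 : f [::] = 0 by rewrite /f shuf_sumE big1 // => l _; rewrite shufZE x0 mulr0.
(* P is known here only as the end t = 0 of the homotopy, from which it inherits linearity. *)
have Plin : linear_on_symf (fun f : W => P (aug f) : W).
  move=> k u v hu hv; rewrite aug_lin -!(homotopy_at0 hXi); try exact: aug_fun.
    have t0 : 0 <= (0 : R) <= 1 by rewrite lexx ler01.
    by have [-> _] := homotopy_linear hXi k (aug_fun hu) (aug_fun hv) t0.
  rewrite -aug_lin; apply: aug_fun; apply: symfD => //; exact: symfZ.
have Pf : P f = \sum_l y l 0 *: (P (xi l) : W).
  rewrite -{1}(aug_id f0) (lsymf_sum Plin); last by move=> l _; apply/symfZ/gco_symf.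
  by apply: eq_bigr => l _; rewrite (lsymfZ Plin) ?aug_id //; apply: gco_symf.
have Qf l : Q f [:: evec l] = 0.
  have := dgd_letter hD (B := B) l sf; rewrite /= (aug_id f0) => ->.
  have /matrixP/(_ l 0) := ay; rewrite !mxE => e; rewrite -[RHS]e.
  apply: eq_bigr => k _; rewrite /f shuf_sumE (bigD1 k) //= big1 ?addr0.
    by rewrite shufZE gco_dual eqxx mulr1.
  by move=> m /negPf mk; rewrite shufZE gco_dual mk mulr0.
have ends : \sum_i x 0 i * (Xi f).1 0 [:: evec i] = \sum_i x 0 i * (Xi f).1 1 [:: evec i].
  have ff := symf_fun sf f0.
  apply: (eq_ends_of_ddt0 (u := fun i t => (Xi f).1 t [:: evec i])) => [i|t ht].
    by have [[_ h] _] := homotopy_form hXi ff; apply: h.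
  rewrite (eq_bigr (fun i => - (\sum_l x 0 i *
    (sg K (gdeg B i) * (a i l * (Xi f).2 t [:: evec l]))))); last first.
    move=> i _; rewrite -[ddt _ _](sgsqK (gdeg B i)) (homotopy_derivative _ ht sf f0 Qf).
    by rewrite !mulrN !mulr_sumr.
  rewrite sumrN exchange_big big1 ?oppr0 //= => l _.
  have /matrixP/(_ 0 l) := xa; rewrite !mxE => e.
  (* As a has degree 1, all i with nonzero [a i l] share one sign, opposite to that of l; it leaves
     the sum, and x a = 0 remains. *)
  transitivity (- (sg K (gdeg B l) * (Xi f).2 t [:: evec l]) * \sum_i x 0 i * a i l);
    last by rewrite e mulr0.
  rewrite mulr_sumr; apply: eq_bigr => i _.
  have [/eqP il|/a0 ->] := eqVneq (1 + gdeg B i - gdeg B l) 0; last by rewrite !(mulr0, mul0r).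
  have -> : sg K (gdeg B l) = - sg K (gdeg B i).
    by rewrite (_ : gdeg B l = gdeg B i + 1) ?sgD ?sg1 ?mulrN1 //; lia.
  ring.
move: ends; rewrite (homotopy_at0 hXi (symf_fun sf f0)) (homotopy_at1 hXi (symf_fun sf f0)).
rewrite Pf /f => ends.
set p := \matrix_(i, l) P (xi l) [:: evec i].
have -> : (kermx a *m (p - 1%:M) *m cokermx a) r s = (x *m (p - 1%:M) *m y) 0 0.
  transitivity ((col s (row r (kermx a *m (p - 1%:M) *m cokermx a))) 0 0).
    by rewrite !mxE.
  by rewrite colE rowE /x /y !mulmxA.
rewrite mulmxBr mulmx1 mulmxBl -mulmxA mxE [X in _ + X]mxE [X in X - _]mxE.
rewrite [X in _ - X]mxE; apply/eqP; rewrite subr_eq0; apply/eqP.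
have pE i : (p *m y) i 0 = (\sum_l y l 0 *: (P (xi l) : W)) [:: evec i].
  rewrite mxE shuf_sumE; apply: eq_bigr => l _.
  by rewrite shufZE mxE mulrC.
under eq_bigr do rewrite pE; rewrite ends; apply: eq_bigr => i _; congr (_ * _).
rewrite shuf_sumE (bigD1 i) //= big1 ?addr0.
  by rewrite shufZE gco_dual eqxx mulr1.
by move=> l /negPf li; rewrite shufZE gco_dual li mulr0.
Qed.

End HomotopyHomology.

(** * Modular classes *)

Section ModularFunction.
Variables (K : numFieldType) (E : lieInfty K) (Q : cochain E -> cochain E).
Hypothesis hQ : is_differential Q.
Local Notation D := (Q \o @aug K E).

(** [hval] selects the component of the total degree and the supertrace that of the basis vector;
    when they differ, both sides are zero. *)
Lemma gco_component (B : gbasis E) i (k : int) (v : forall e : int, E e) :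
  (forall e, e != k -> v e = 0) ->
  gco B i [:: hom_of (v k)] = gco B i [:: hom_of (v (gdeg B i))].
Proof.
move=> hv; have [<- //|ne] := eqVneq (gdeg B i) k.
rewrite (hv (gdeg B i)) // [RHS](symf_zero [::] [::] (gdeg B i) (gco_symf B i)).
apply: (gco_hdeg B i); rewrite deg_cons deg_nil addr0 opprK.
by rewrite eq_sym.
Qed.

(** By [differential_dual] the diagonal entry at i is the coefficient of e_i in the bracket of s and
    e_i, with the sign of the degree of xi_i; this is the sign of the supertrace. *)
Lemma modular_functionE (B : gbasis E) :
  @modular_function K E = \tr (conn B D) :> shuf E.
Proof.
have hB := @bracket_multimap _ E.
apply/funext=> s; rewrite /modular_function /supertrace (gco_supertrace B).
rewrite /mxtrace shuf_sumE; apply: eq_bigr => i _; rewrite mxE /dr /= aug_id ?gco_nil //.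
have xl : linear_form (gco B i : cochain E).
  split; last exact: gco_linear.
  by apply/is_functionP; split; [apply: gco_symf|apply: gco_nil].
have xd : fun_of_degree (- gdeg B i) (gco B i : cochain E).
  by split; [case: xl|apply: gco_hdeg].
rewrite (differential_dual hQ xl xd) -/(sg K _) sgN; congr (_ * _).
rewrite /hval (gco_component _ (v := @bracket _ E (rcons s (hom_of (gvec B i))))) //.
by move=> e ne; apply: (multimap_degree hB).
Qed.

Lemma modular_function_degree : fun_of_degree 1 (@modular_function K E).
Proof.
have [B] := gbasis_exists E; rewrite (modular_functionE B).
have hD := is_differential_dg hQ.
have hA : hdeg 1 (\tr (conn B D)).
  apply: hdeg_sum => i _; have [_] := mxdeg_conn (B := B) hD i i.
  by rewrite addrK.
split=> //; apply/is_functionP; split; last by rewrite hA // deg_nil.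
by apply: symf_sum => i _; case: (mxdeg_conn (B := B) hD i i).
Qed.

End ModularFunction.

Section MorphismPair.
Variables (R : realType) (c : ground) (E F : lieInfty (scalars R c)).
Variables (QE : cochain E -> cochain E) (QF : cochain F -> cochain F).
Variables (P : cochain F -> cochain E) (P' : cochain E -> cochain F).
Hypotheses (hQE : is_differential QE) (hQF : is_differential QF).
Hypotheses (hP : is_morphism QE QF P) (hP' : is_morphism QF QE P').
Local Notation K := (scalars R c).

Lemma jac_comp (B : gbasis E) (C : gbasis F) (j := \matrix_(i, l) jac B C (unital_ext P) i l [::])
    (k := \matrix_(i, l) jac C B (unital_ext P') i l [::]) :
  \matrix_(i, l) (P \o P') (gco B l) [:: hom_of (gvec B i)] = j *m k.
Proof.
have dP := is_morphism_dg hQF hP; have dP' := is_morphism_dg hQE hP'.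
apply/matrixP => i l; rewrite !mxE /=.
have x0 : gco B l [::] = 0 by apply: gco_nil.
have fx : is_function (gco B l : cochain E).
  by apply/is_functionP; split=> //; apply: gco_symf.
have /is_functionP[sx px0] := morphism_fun hP' fx.
have := dgm_letter C dP i sx; rewrite {1}/unital_ext px0 scale0r add0r aug_id // => ->.
apply: eq_bigr => m _; rewrite !mxE; congr (_ * _).
by rewrite /dr /= /unital_ext x0 scale0r add0r aug_id.
Qed.

Lemma jac_chain (B : gbasis E) (C : gbasis F) 
    (j := \matrix_(i, l) jac B C (unital_ext P) i l [::]) :
  arity0 (conn B (QE \o @aug _ E)) *m j = j *m arity0 (conn C (QF \o @aug _ F)).
Proof.
have dP := is_morphism_dg hQF hP.
have dE := is_differential_dg hQE; have dF := is_differential_dg hQF.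
apply/matrixP => i l; rewrite !mxE.
have := jac_intertwines (B := B) (C := C) dE dF dP i l.
move=> /(congr1 (fun f : shuf E => f [::])).
rewrite shufDE shufZE (dgd_nil dE) ?mulr0 ?add0r; last by case: (jac_deg dP i l).
rewrite !shuf_sumE => e.
transitivity (\sum_b (conn B (QE \o @aug _ E) i b * jac B C (unital_ext P) b l) [::]).
  by apply: eq_bigr => b _; rewrite shuf_mul_nil [arity0 _ _ _]mxE [j _ _]mxE.
rewrite e; apply: eq_bigr => b _; rewrite shuf_mul_nil [arity0 _ _ _]mxE [j _ _]mxE.
by rewrite (dgm_nil dP) //; case: (mxdeg_conn (B := C) dF b l).
Qed.

End MorphismPair.

Section Invariance.
Variables (R : realType) (c : ground) (E F : lieInfty (scalars R c)).
Variables (QE : cochain E -> cochain E) (QF : cochain F -> cochain F).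
Variables (P : cochain F -> cochain E) (P' : cochain E -> cochain F).
Hypotheses (hQE : is_differential QE) (hQF : is_differential QF).
Hypotheses (hP : is_morphism QE QF P) (hP' : is_morphism QF QE P').
Hypotheses (hE : homotopic QE QE (P \o P') id) (hF : homotopic QF QF (P' \o P) id).
Local Notation K := (scalars R c).

Lemma modular_function_morphism : exists L : shuf E,
  fun_of_degree 0 L /\
  QE L = (@modular_function K E : shuf E) - P (@modular_function K F).
Proof.
have [B] := gbasis_exists E; have [C] := gbasis_exists F.
have dP := is_morphism_dg hQF hP.
have dE := is_differential_dg hQE; have dF := is_differential_dg hQF.

have [|L [sL L0 dL QL]] := dg_morphism_trace (B := B) (C := C) dE dF dP.
  apply: (cone_acyclic (k := \matrix_(i, l) jac C B (unital_ext P') i l [::])).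
  - apply: (arity0_flat dF _ (conn_flat C dF)) => i l.
    by case: (mxdeg_conn (B := C) dF i l).
  - exact: jac_chain.
  - exact: jac_chain.
  - rewrite -(jac_comp hQE hQF hP hP'); have [Xi hXi] := hE.
    exact: homotopy_homology hQE hXi.
  - rewrite -(jac_comp hQF hQE hP' hP); have [Xi hXi] := hF.
    exact: homotopy_homology hQF hXi.
exists L; split; first by split=> //; apply/is_functionP.
move: QL; rewrite /= (aug_id L0) -!modular_functionE // => ->.
have [/is_functionP[_ w0] _] := modular_function_degree hQF.
by rewrite /unital_ext w0 scale0r add0r (aug_id w0).
Qed.

(** Both sides are cosets of exact functions, and L shifts one representative to the other: P (w_F +
    QF g) + QE g' is w_E + QE (- L + P g + g'), and w_E + QE g is P w_F + QE (L + g), with w_E and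
    w_F the modular functions. *)
Lemma coh_map_modular_class :
  coh_map QE 1 P (modular_class QF) = modular_class QE.
Proof.
have [L [dL eL]] := modular_function_morphism.
have dE := is_differential_dg hQE; have dF := is_differential_dg hQF.
have QEE f : is_function f -> QE f = (QE \o @aug _ E) f.
  by move=> /is_functionP[_ f0]; rewrite /= aug_id.
have PD (f g : shuf F) : is_function f -> is_function g ->
    P (f + g) = (P f : shuf E) + P g.
  move=> hf hg; have := morphism_linear hP 1 hf hg.
  rewrite (_ : (1 \*o f) \+ g = f + g); last by apply/funext=> s; rewrite /= mul1r.
  by move=> ->; apply/funext=> s; rewrite shufDE /= mul1r.
have [fw _] := modular_function_degree hQF.
have fD (f g : shuf E) : fun_of_degree 0 f -> fun_of_degree 0 g -> fun_of_degree 0 (f + g).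
  move=> [/is_functionP[sf f0] df] [/is_functionP[sg g0] dg].
  split; last exact: hdegD.
  by apply/is_functionP; split; [apply: symfD|rewrite shufDE f0 g0 addr0].
have QED (f g : shuf E) : fun_of_degree 0 f -> fun_of_degree 0 g ->
    QE (f + g) = (QE f : shuf E) + QE g.
  move=> hf hg; have [ffg _] := fD f g hf hg; rewrite !QEE ?(lsymfD (dgd_lin dE)) //.
  - by case: hf => /is_functionP[].
  - by case: hg => /is_functionP[].
  - by case: hg.
  - by case: hf.
apply/seteqP; split=> [h [_ [g dg ->] [g' dg' ->]]|h [g dg ->]].
  have dNL : fun_of_degree 0 (- L).
    have [/is_functionP[sL L0] hL] := dL; split; last exact: hdegN.
    by apply/is_functionP; split; [apply: symfN|rewrite shufNE L0 oppr0].
  have dPg : fun_of_degree 0 (P g) := morphism_degree hP dg.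
  have QNL : QE (- L) = - (QE L : shuf E).
    have [/is_functionP[sL _] _] := dL.
    by rewrite !QEE ?(lsymfN (dgd_lin dE)) //; first [by case: dL|by case: dNL].
  exists (- L + (P g + g')); first exact: fD dNL (fD _ _ dPg dg').
  have fQg : is_function (QF g) by apply: differential_fun hQF _ _; case: dg.
  have -> : QE (- L + (P g + g')) =
      - (QE L : shuf E) + ((QE (P g) : shuf E) + QE g') :> shuf E.
    by rewrite QED ?QNL ?QED //; apply: fD.
  have -> : P (@modular_function _ F \+ QF g) =
      (P (@modular_function _ F) : shuf E) + QE (P g) :> shuf E.
    by rewrite -(morphism_differential hP) ?PD //; case: dg.
  rewrite eL; apply/funext=> s.
  rewrite -![(_ \+ _) s]/(_ s + _ s) !(shufDE, shufNE); ring.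
have d0 : fun_of_degree 0 (0 : shuf F).
  by split; [apply/is_functionP; split; [apply: symf0|]|apply: hdeg0].
exists (@modular_function _ F).
  exists (0 : shuf F) => //.
  have -> : QF (0 : shuf F) = 0 :> shuf F.
    by have := lsymf0 (dgd_lin dF); rewrite /= (aug_id (shuf0E [::])).
  by apply/funext=> s; rewrite /= shuf0E addr0.
exists (L + g); first exact: fD.
rewrite QED // eL; apply/funext=> s.
rewrite -![(_ \+ _) s]/(_ s + _ s) !(shufDE, shufNE); ring.
Qed.

End Invariance.

Theorem proposition2p7 (R : realType) (c : ground)
    (E F : lieInfty (scalars R c))
    (QE : cochain E -> cochain E) (QF : cochain F -> cochain F)
    (hQE : is_differential QE) (hQF : is_differential QF)
    (Phi : cochain E -> cochain F) (Psi : cochain F -> cochain E)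
    (hPhiPsi : homotopy_equivalence QE QF Phi Psi) :
  coh_map QF 1 Phi (modular_class QE) = modular_class QF /\
  coh_map QE 1 Psi (modular_class QF) = modular_class QE.
Proof.
have [hPhi hPsi hF hE] := hPhiPsi.
by split; [apply: (coh_map_modular_class (P' := Psi))|apply: (coh_map_modular_class (P' := Phi))].
Qed.
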